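(* Fix $\alpha,\beta\in\mathbb N^{\mathbb Z/n\mathbb Z}$ and $d\in\mathbb N^{(\mathbb Z)}$ such that $\bar d=\alpha+\beta$. Then for all $f\in\mathbf U^-_{n,\alpha}$ and $g\in\mathbf U^-_{n,\beta}$, $$\sum_{\substack{a+b=d\\ \bar a=\alpha,\ \bar b=\beta}}v^{-k(b,a)}\,\gamma_a(f)\circ\gamma_b(g)=\gamma_d(f\circ g),$$ where $a,b$ run over $\mathbb N^{(\mathbb Z)}$ and $k(b,a)=\sum_{i>j,\ \bar\imath=\bar\jmath}b_i(2a_j-a_{j-1}-a_{j+1})$.
   Context: $n\in\mathbb N^\times$, $\mathbb A=\mathbb C[v,v^{-1}]$, $\bar\imath$ is the class of $i$ mod $n$; for $d\in\mathbb N^{(\mathbb Z)}$ (finitely supported), $\bar d\in\mathbb N^{\mathbb Z/n\mathbb Z}$ is $\bar d_{\bar\imath}=\sum_{j\in\bar\imath}d_j$. Hall algebras. $\Gamma_n$ is the cyclic quiver with vertex set $I=\mathbb Z/n\mathbb Z$ and arrows $\bar\imath\to\bar\imath+1$; $\Gamma_\infty$ has $I=\mathbb Z$ and arrows $i\to i+1$. For an $I$-graded finite-dimensional space $V$ of dimension $d\in\mathbb N^{(I)}$, $E_V$ is the set of nilpotent representations $x=(x_i:V_i\to V_{i+1})_i$ and $G_V=\prod GL(V_i)$. Over a finite field $\mathbb F$ with $q^2$ elements, let $\mathbf A_d=\mathbb C_{G_V}(E_V)$ be the space of $G_V$-invariant functions, and for $f\in\mathbf A_a,g\in\mathbf A_b$,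 $d=a+b$, set $(f\circ g)(x)=q^{-m(b,a)}\sum_U f(x|_U)\,g(x|_{V/U})$, the sum over $x$-stable graded $U\subset V$ of dimension $a$, with $m(b,a)=\sum_i b_ia_{i+1}+\sum_ib_ia_i$. Orbits are classified independently of the field, and the structure constants on the characteristic functions of orbits are values at $v=q^{-1}$ of universal elements of $\mathbb A$; the resulting $\mathbb A$-algebras (generic Hall algebras) are $\mathbf U_n^-=\bigoplus_d\mathbf U^-_{n,d}$ (for $\Gamma_n$) and $\mathbf U_\infty^-=\bigoplus_d\mathbf U^-_{\infty,d}$ (for $\Gamma_\infty$). The map $\gamma_d$. Let $d\in\mathbb N^{(\mathbb Z)}$, $V$ a $\mathbb Z$-graded space of dimension $d$, $\bar V$ the $\mathbb Z/n$-graded space $\bar V_{\bar\imath}=\bigoplus_{j\in\bar\imath}V_j$, $\bar V_{\ge i}=\bigoplus_{j\ge i}V_j$, $E_{\bar V,V}=\{y\in E_{\bar V}: y(\bar V_{\ge i})\subseteq\bar V_{\ge i+1}\ \forall i\}$, and $p:E_{\bar V,V}\to E_V$ the map sending $y$ to its associated graded representation. $\gamma_d:\mathbf U^-_{n,\bar d}\to\mathbf U^-_{\infty,d}$ is the $\mathbb A$-linear map which at $v=q^{-1}$ is $(\gamma_df)(x)=q^{-h(d)}\sum_{y\in p^{-1}(x)}f(y)$, with $h(d)=\sum_{i<j,\ \bar\imath=\bar\jmath}d_i(d_{j+1}-d_j)$. *)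

(* Defs.v *)
From HB Require Import structures.
From mathcomp Require Import all_boot all_order all_algebra finmap.
From mathcomp.multinomials Require Import monalg.
From mathcomp Require Import boolp classical_sets fsbigop reals.
From mathcomp Require Import complex.

Set Implicit Arguments.
Unset Strict Implicit.
Unset Printing Implicit Defensive.

Import Order.TTheory GRing.Theory Num.Theory.

Local Open Scope ring_scope.

(** * The ring C[v, v^-1] *)

Section Laurent.
Variable C : fieldType.

(* C[v, v^-1] is realized inside the fraction field of C[v]. *)
Definition is_laurent (x : {fraction {poly C}}) : Prop :=
  exists pk : {poly C} * nat, x = tofrac pk.1 / tofrac 'X ^+ pk.2.

Definition laurent_pred : {pred {fraction {poly C}}} :=
  fun x => `[< is_laurent x >].

Let tofracX_neq0 k : tofrac ('X : {poly C}) ^+ k != 0.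
Proof. by rewrite expf_neq0 // tofrac_eq0 polyX_eq0. Qed.

Fact laurent_subring : subring_closed laurent_pred.
Proof.
split.
- by apply/asboolP; exists (1, 0%N); rewrite /= tofrac1 expr0 divr1.
- move=> x y /asboolP[[p k] ->] /asboolP[[r l] ->] /=; apply/asboolP.
  exists (p * 'X^l - r * 'X^k, (k + l)%N) => /=.
  rewrite -mulNr addf_div ?tofracX_neq0 // exprD.
  by rewrite tofracD tofracN !tofracM !tofracXn mulNr.
- move=> x y /asboolP[[p k] ->] /asboolP[[r l] ->] /=; apply/asboolP.
  exists (p * r, (k + l)%N) => /=.
  by rewrite mulf_div tofracM exprD.
Qed.

HB.instance Definition _ :=
  GRing.isSubringClosed.Build {fraction {poly C}} laurent_pred laurent_subring.

Record laurent := Laurent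
  { laurent_val :> {fraction {poly C}};
    laurent_valP : laurent_val \in laurent_pred }.

HB.instance Definition _ := [isSub for laurent_val].
HB.instance Definition _ := [Choice of laurent by <:].
HB.instance Definition _ := [SubChoice_isSubComNzRing of laurent by <:].

Fact vpow_subproof (k : int) : tofrac ('X : {poly C}) ^ k \in laurent_pred.
Proof.
apply/asboolP; case: k => k.
- by exists ('X^k, 0%N); rewrite /= expr0 divr1 tofracXn.
- by exists (1, k.+1); rewrite /= tofrac1 div1r.
Qed.

Definition vpow (k : int) : laurent := Laurent (vpow_subproof k).

(* The value at v = t; see leval_frac for the independence of the choice. *)
Definition leval (x : laurent) (t : C) : C :=
  let pk := projT1 (cid (asboolW (laurent_valP x))) in pk.1.[t] / t ^+ pk.2.

Lemma leval_frac (x : laurent) (p : {poly C}) (k : nat) (t : C) :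
  t != 0 -> laurent_val x = tofrac p / tofrac 'X ^+ k ->
  leval x t = p.[t] / t ^+ k.
Proof.
move=> t0 xE; rewrite /leval; case: cid => -[r l] /= rE.
move: rE; rewrite xE => /eqP; rewrite eqr_div ?tofracX_neq0 //.
rewrite -!tofracXn -!tofracM tofrac_eq => /eqP /(congr1 (fun u => u.[t])).
rewrite !hornerM !hornerXn => E; apply/eqP.
by rewrite eqr_div ?expf_neq0 // E.
Qed.

End Laurent.

(** * Dimension vectors and multisegments *)

Notation dimvec I := {fsfun I -> nat with 0%N}.

Definition dadd (I : choiceType) (a b : dimvec I) : dimvec I :=
  [fsfun i in (finsupp a `|` finsupp b)%fset => (a i + b i)%N].

(* The class of an integer modulo n.+1. *)
Definition cls (n : nat) (i : int) : 'I_n.+1 := inord `|(i %% n.+1%:Z)%Z|.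

Definition dbar (n : nat) (d : dimvec int) : dimvec 'I_n.+1 :=
  [fsfun c in [fset cls n j | j in finsupp d]%fset =>
     (\sum_(j <- finsupp d | cls n j == c) d j)%N].

(* A multisegment labels an isomorphism class of nilpotent representations:
   lam (i, l) is the number of indecomposable summands of dimension l.+1 with
   a generator in degree i. *)
Notation mseg I := {fsfun (I * nat)%type -> nat with 0%N}.

(** * Representations of the quiver with vertex set I and arrows i -> s i *)

(* The arrow i -> i + 1 of the infinite quiver; the cyclic quiver uses ordS. *)
Definition succz (i : int) : int := i + 1.

(* The space 'rV_N, with a family of subspaces (row spaces) and an
   endomorphism (acting on row vectors from the right). *)
Record grep (F : fieldType) (I : Type) := GRep {
  gdim : nat;
  gr : I -> 'M[F]_gdim;
  act : 'M[F]_gdim }.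

Section Quiver.
Variables (I : choiceType) (s : I -> I).

Definition mdim (lam : mseg I) (i : I) : nat :=
  (\sum_(p <- finsupp lam)
     lam p * count (fun k => iter k s p.1 == i) (iota 0 p.2.+1))%N.

Definition mform (b a : dimvec I) : nat :=
  (\sum_(i <- finsupp b) (b i * a (s i) + b i * a i))%N.

Section Field.
Variable F : fieldType.
Implicit Types (V W : grep F I) (a b d : dimvec I).

(* The sum of the homogeneous components is direct by the dimension count. *)
Definition graded d V : Prop :=
  [/\ forall i, \rank (gr V i) = d i,
      gdim V = (\sum_(i <- finsupp d) d i)%N
    & row_full (\sum_(i <- finsupp d) gr V i)%MS].

Definition is_rep d V : Prop :=
  [/\ graded d V,
      forall i, (gr V i *m act V <= gr V (s i))%MS
    & exists m, act V ^+ m = 0].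

Definition iso V W : Prop :=
  exists (g : 'M[F]_(gdim V, gdim W)) (h : 'M[F]_(gdim W, gdim V)),
    [/\ g *m h = 1%:M, h *m g = 1%:M, act V *m g = g *m act W
      & forall i, (gr V i *m g == gr W i)%MS].

(* A basis of the representation labelled by lam: the vector (p, m, k) is the
   image under k arrows of the generator of the m-th copy of the segment p. *)
Definition mbasis (lam : mseg I) : seq ((I * nat) * nat * nat) :=
  [seq (pm, k) | pm <- [seq (p, m) | p <- finsupp lam, m <- iota 0 (lam p)],
                 k <- iota 0 pm.1.2.+1].

Definition mdeg (e : (I * nat) * nat * nat) : I := iter e.2 s e.1.1.1.

Definition mrep (lam : mseg I) : grep F I :=
  let e := tnth (in_tuple (mbasis lam)) in
  GRep (fun i => diag_mx (\row_t (mdeg (e t) == i)%:R))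
       (\matrix_(t, u) (e u == ((e t).1, (e t).2.+1))%:R).

(* U is a graded subrepresentation of dimension a. The first condition selects
   one matrix for each row space. *)
Definition subrep a V (U : 'M[F]_(gdim V)) : Prop :=
  [/\ <<U>>%MS = U,
      (U *m act V <= U)%MS,
      (U <= \sum_(i <- finsupp a) (gr V i :&: U))%MS
    & forall i, \rank (gr V i :&: U)%MS = a i].

(* x|_U, in the coordinates given by the basis row_base U of U. *)
Definition restr V (U : 'M[F]_(gdim V)) : grep F I :=
  GRep (fun i => <<(gr V i :&: U) *m pinvmx (row_base U)>>%MS)
       (row_base U *m act V *m pinvmx (row_base U)).

(* x|_{V/U}; col_base (cokermx U) is a surjection with kernel U. *)
Definition quo V (U : 'M[F]_(gdim V)) : grep F I :=
  let pi := col_base (cokermx U) in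
  GRep (fun i => <<gr V i *m pi>>%MS) (pinvmx pi *m act V *m pi).

End Field.

(* The invariant functions are represented as functions of all
   representations, rather than of those on one fixed graded space. *)
Definition hallprod (C : fieldType) (F : finFieldType) (q : C)
    (a b : dimvec I) (f g : grep F I -> C) (V : grep F I) : C :=
  q ^- mform b a *
  \sum_(U : 'M[F]_(gdim V) | `[< subrep a U >]) f (restr U) * g (quo U).

End Quiver.

(** * Generic Hall algebras *)

Section Generic.
Variable R : realType.
Notation A := (laurent R[i]).

(* {malg A[mseg I]} is the free C[v, v^-1]-module on the orbits. *)

Section Alg.
Variables (I : choiceType) (s : I -> I).

Definition homog (d : dimvec I) (f : {malg A[mseg I]}) : Prop :=
  forall lam, lam \in msupp f -> forall i, mdim s lam i = d i.

(* The value of f at v = q^-1, as a function on representations over F; the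
   basis element lam specializes to the characteristic function of its orbit. *)
Definition special (F : finFieldType) (q : R[i]) (f : {malg A[mseg I]})
    (V : grep F I) : R[i] :=
  \sum_(lam <- msupp f) leval f@_lam q^-1 * `[< iso V (mrep s F lam) >]%:R.

(* The product given by the universal structure constants (Hall polynomials).
   Since infinitely many q occur, hmul_special determines hmul on homogeneous
   elements, hence everywhere by bilinearity. *)
Record hall_algebra := HallAlgebra {
  hmul : {malg A[mseg I]} -> {malg A[mseg I]} -> {malg A[mseg I]};
  hmul_linear_r : forall f, linear (hmul f);
  hmul_linear_l : forall g, linear (hmul^~ g);
  hmul_homog : forall a b f g,
    homog a f -> homog b g -> homog (dadd a b) (hmul f g);
  hmul_special : forall (F : finFieldType) (q : R[i]),
    0 < q -> q ^+ 2 = #|F|%:R ->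
    forall a b f g, homog a f -> homog b g ->
    forall V : grep F I, is_rep s (dadd a b) V ->
    special q (hmul f g) V =
    hallprod s q a b (special q f) (special q g) V }.

End Alg.

(** * The maps gamma_d *)

Section Gamma.
Variable n : nat.

Section Field.
Variables (F : fieldType) (d : dimvec int) (V : grep F int).

(* The Z/n-graded space obtained from V, with an endomorphism y. *)
Definition barrep (y : 'M[F]_(gdim V)) : grep F 'I_n.+1 :=
  GRep (fun c => \sum_(j <- finsupp d | cls n j == c) gr V j)%MS y.

Definition fge (i : int) : 'M[F]_(gdim V) :=
  (\sum_(j <- finsupp d | (i <= j)%R) gr V j)%MS.

Definition filtered (y : 'M[F]_(gdim V)) : Prop :=
  is_rep (@ordS n.+1) (dbar n d) (barrep y) /\
  forall i, (fge i *m y <= fge (i + 1))%MS.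

(* p(y) = x, with fge i / fge (i + 1) identified with gr V i. *)
Definition assoc_gr (y x : 'M[F]_(gdim V)) : Prop :=
  forall i, (gr V i *m (y - x) <= fge (i + 2))%MS.

End Field.

Definition hform (d : dimvec int) : int :=
  \sum_(p \in [set p : int * int | p.1 < p.2 /\ cls n p.1 = cls n p.2]%classic)
    (d p.1)%:Z * ((d (p.2 + 1)%R)%:Z - (d p.2)%:Z).

Definition kform (b a : dimvec int) : int :=
  \sum_(p \in [set p : int * int | p.2 < p.1 /\ cls n p.1 = cls n p.2]%classic)
    (b p.1)%:Z *
    (2 * (a p.2)%:Z - (a (p.2 - 1)%R)%:Z - (a (p.2 + 1)%R)%:Z).

Definition gammaF (F : finFieldType) (q : R[i]) (d : dimvec int)
    (f : grep F 'I_n.+1 -> R[i]) (V : grep F int) : R[i] :=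
  q ^ (- hform d) *
  \sum_(y : 'M[F]_(gdim V) | `[< filtered d y /\ assoc_gr d y (act V) >])
    f (barrep d y).

(* gam d is determined on the component of dimension dbar n d only, which is
   the domain of gamma_d. *)
Record gamma_maps := GammaMaps {
  gam : dimvec int -> {linear {malg A[mseg 'I_n.+1]} -> {malg A[mseg int]}};
  gam_homog : forall d f,
    homog (@ordS n.+1) (dbar n d) f -> homog succz d (gam d f);
  gam_special : forall (F : finFieldType) (q : R[i]),
    0 < q -> q ^+ 2 = #|F|%:R ->
    forall d f, homog (@ordS n.+1) (dbar n d) f ->
    forall V : grep F int, is_rep succz d V ->
    special succz q (gam d f) V =
    gammaF q d (special (@ordS n.+1) q f) V }.

End Gamma.
End Generic.

(* Main.v *)
(* Both sides are determined by their values at v = q^-1 on the standard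
   representations x of the infinite quiver. Expanding the right-hand side at x
   gives a sum over pairs (y, W) with y over x for the filtration and W a
   y-stable Z/n-graded subspace. The associated graded U of W for the filtration
   of V is an x-stable Z-graded subspace, whose dimension is a = dim U. In a
   homogeneous basis adapted to U, the subspaces W with associated graded U are
   the graphs of the maps T from U to its complement that raise the degree by a
   positive multiple of the period. Conjugation by 1 + T reduces to W = U, and the y that
   stabilize U are block triangular, with diagonal blocks lying over the
   restriction and the quotient of x and an arbitrary strictly filtered
   off-diagonal block. Hence the fiber over U contributes the term of U on the
   left-hand side up to a power of q, and the exponents agree. *)

Require Import Defs.
From HB Require Import structures.
From mathcomp Require Import all_boot all_order all_algebra finmap.
From mathcomp.multinomials Require Import monalg.
From mathcomp Require Import boolp classical_sets fsbigop reals.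
From mathcomp Require Import complex.
From mathcomp Require Import zify.
Set Implicit Arguments.
Unset Strict Implicit.
Unset Printing Implicit Defensive.
Import Order.TTheory GRing.Theory Num.Theory.
Local Open Scope ring_scope.

(** * Degree projections and coordinate representations *)

Section DegreeProjections.
Variable F : fieldType.

(** All spaces are coordinate spaces whose basis vectors carry integer degrees, so a condition on a
    map says which matrix entries may be nonzero. Each such condition has two parameters: a lower
    bound for the shift of degree, and the residue of the shift modulo the period. The maps T have
    (1, 0), and y - x has (2, 1). Both parameters add under composition; y itself has (1, 1), so its
    composite with T has (2, 1) again, which is why conjugation by 1 + T stays in the fiber over x.
    The matrices with prescribed support number |F| = q^2 to the number of admissible positions, so
    every power of q is a count of pairs of basis vectors. Since [restr] and [quo] are written in
    arbitrarily chosen bases, functions are compared up to [iso] throughout. Restricting to standard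
    representations loses nothing: over Z the ranks of the iterated arrows recover the
    multisegment. *)

Definition dmx m (P : pred 'I_m) : 'M[F]_m := diag_mx (\row_t (P t)%:R).

Lemma dmx_mulE m n (P : pred 'I_m) (M : 'M[F]_(m, n)) t u :
  (dmx P *m M) t u = if P t then M t u else 0.
Proof. by rewrite mul_diag_mx !mxE; case: (P t); rewrite ?mul1r ?mul0r. Qed.

Lemma mul_dmxE m n (P : pred 'I_n) (M : 'M[F]_(m, n)) t u :
  (M *m dmx P) t u = if P u then M t u else 0.
Proof. by rewrite mul_mx_diag !mxE; case: (P u); rewrite ?mulr1 ?mulr0. Qed.

Lemma dmxM m (P Q : pred 'I_m) : dmx P *m dmx Q = dmx (predI P Q).
Proof.
apply/matrixP => t u; rewrite dmx_mulE !mxE /=.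
by case: (P t) => //=; case: eqP => // _; rewrite mul0rn.
Qed.

Lemma eq_dmx m (P Q : pred 'I_m) : P =1 Q -> dmx P = dmx Q.
Proof. by move=> PQ; apply/matrixP => t u; rewrite !mxE PQ. Qed.

Lemma dmx_idem m (P : pred 'I_m) : dmx P *m dmx P = dmx P.
Proof. by rewrite dmxM; apply: eq_dmx => t /=; rewrite andbb. Qed.

Lemma dmx_id m n (P : pred 'I_n) (M : 'M[F]_(m, n)) :
  (forall t u, M t u != 0 -> P u) -> M *m dmx P = M.
Proof.
move=> MP; apply/matrixP => t u; rewrite mul_dmxE; case: ifP => // /negP Pu.
by apply/esym/eqP/negPn/negP => /MP.
Qed.

Lemma sub_dmxE m n (P : pred 'I_n) (M : 'M[F]_(m, n)) :
  (M <= dmx P)%MS = (M *m dmx P == M).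
Proof.
apply/idP/eqP => [/submxP[D ->]|<-]; last exact: submxMl.
by rewrite -mulmxA dmx_idem.
Qed.

Lemma sub_dmxP m n (P : pred 'I_n) (M : 'M[F]_(m, n)) :
  reflect (forall t u, M t u != 0 -> P u) (M <= dmx P)%MS.
Proof.
apply: (iffP idP); rewrite sub_dmxE; last by move=> /dmx_id ->.
move=> /eqP <- t u; rewrite mul_dmxE.
by case: (P u) => //; rewrite eqxx.
Qed.

Lemma dmx_sum_id m n (J : choiceType) (deg : 'I_n -> J) (r : seq J)
    (M : 'M[F]_(m, n)) :
  uniq r -> (forall t, deg t \in r) ->
  \sum_(i <- r) M *m dmx (fun t => deg t == i) = M.
Proof.
move=> ur degr; apply/matrixP => t u; rewrite summxE.
rewrite (bigD1_seq (deg u)) //= mul_dmxE eqxx big1 ?addr0 // => i /negbTE.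
by rewrite mul_dmxE eq_sym => ->.
Qed.

Lemma rank_dmx m (P : pred 'I_m) : \rank (dmx P) = #|P|.
Proof.
pose f (k : 'I_#|P|) := enum_val k.
have finj : injective f by apply: enum_val_inj.
have fP k : P (f k) by apply: (enum_valP k).
have -> : #|P| = \rank (rowsub f (1%:M : 'M[F]_m)).
  apply/esym/eqP; rewrite -[_ == _]/(row_free _).
  apply/row_freeP; exists (colsub f 1%:M).
  apply/matrixP => k l; rewrite !mxE (bigD1 (f l)) //= !mxE eqxx mulr1 big1.
    by rewrite addr0 (inj_eq finj).
  by move=> j /negbTE jl; rewrite !mxE jl mulr0.
apply: eqmx_rank.
apply/andP; split; last first.
  by apply/sub_dmxP => t u; rewrite !mxE; case: (f t =P u) => [<-|]; rewrite ?fP ?eqxx.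
apply/row_subP => t; have [Pt|/negbTE Pt] := boolP (P t); last first.
  suff -> : row t (dmx P) = 0 by rewrite sub0mx.
  by apply/rowP => u; rewrite !mxE Pt mul0rn.
have tP : t \in P by [].
suff -> : row t (dmx P) = row (enum_rank_in tP t) (rowsub f 1%:M).
  exact: row_sub.
by apply/rowP => u; rewrite !mxE Pt /f enum_rankK_in.
Qed.

End DegreeProjections.

Section SeqSums.
Variables (F : fieldType) (J : eqType) (n : nat) (B : J -> 'M[F]_n).

Lemma sumsmx_seq_sup m (A : 'M[F]_(m, n)) (Q : pred J) (r : seq J) i :
  i \in r -> Q i -> (A <= B i)%MS -> (A <= \sum_(j <- r | Q j) B j)%MS.
Proof.
move=> ir Qi AB; rewrite (big_rem i ir) Qi /=.
by apply: submx_trans AB _; apply: addsmxSl.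
Qed.

Lemma sumsmx_seq_sub m (A : 'M[F]_(m, n)) (Q : pred J) (r : seq J) :
  (forall i, i \in r -> Q i -> (B i <= A)%MS) ->
  (\sum_(j <- r | Q j) B j <= A)%MS.
Proof.
move=> BA; rewrite big_seq_cond; elim/big_rec: _ => [|i X /andP[ir Qi] XA].
  exact: sub0mx.
by rewrite addsmx_sub BA.
Qed.

End SeqSums.

Section CoordinateRepresentations.
Variables (F : fieldType) (J : choiceType).

(** This is the form that [mrep] has by definition, so [mrepE] is a conversion. *)
Definition crep m (deg : 'I_m -> J) (x : 'M[F]_m) : grep F J :=
  GRep (fun i => dmx F (fun t => deg t == i)) x.

Definition preserves m n (deg' : 'I_m -> J) (deg : 'I_n -> J)
    (M : 'M[F]_(m, n)) : Prop :=
  forall t u, M t u != 0 -> deg' t = deg u.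

Lemma preserves_comm m n (deg' : 'I_m -> J) (deg : 'I_n -> J)
    (M : 'M[F]_(m, n)) i :
  preserves deg' deg M ->
  M *m dmx F (fun t => deg t == i) = dmx F (fun t => deg' t == i) *m M.
Proof.
move=> Mdeg; apply/matrixP => t u; rewrite mul_dmxE dmx_mulE.
have [->|/Mdeg ->//] := eqVneq (M t u) 0; by do 2 case: ifP.
Qed.

Lemma comm_preserves m n (deg' : 'I_m -> J) (deg : 'I_n -> J)
    (M : 'M[F]_(m, n)) :
  (forall i, M *m dmx F (fun t => deg t == i) =
             dmx F (fun t => deg' t == i) *m M) ->
  preserves deg' deg M.
Proof.
move=> Mcomm t u Mtu; move/matrixP/(_ t u): (Mcomm (deg u)).
by rewrite mul_dmxE dmx_mulE eqxx; case: eqP => // _ M0; rewrite M0 eqxx in Mtu.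
Qed.

Lemma isoR (V : grep F J) : iso V V.
Proof.
exists 1%:M, 1%:M; split; rewrite ?mulmx1 ?mul1mx //.
by move=> i; rewrite mulmx1 submx_refl.
Qed.

Lemma isoS (V W : grep F J) : iso V W -> iso W V.
Proof.
case=> g [h [gh hg gact ggr]]; exists h, g; split=> //.
  by rewrite -[LHS]mul1mx -hg -mulmxA (mulmxA g) -gact -mulmxA gh mulmx1.
move=> i; have /andP[le1 le2] := ggr i; rewrite -{2}[gr V i]mulmx1 -gh mulmxA.
by apply/andP; split; last exact: submxMr; rewrite (submx_trans (submxMr _ le2)) //
  -mulmxA gh mulmx1.
Qed.

Lemma isoT (V W X : grep F J) : iso V W -> iso W X -> iso V X.
Proof.
case=> g [h [gh hg gact ggr]] [g' [h' [gh' hg' gact' ggr']]].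
exists (g *m g'), (h' *m h); split.
- by rewrite mulmxA -(mulmxA g) gh' mulmx1.
- by rewrite mulmxA -(mulmxA h') hg mulmx1.
- by rewrite mulmxA gact -!mulmxA gact'.
- move=> i; rewrite mulmxA; apply/andP.
  have /andP[le1 le2] := ggr i; have /andP[le1' le2'] := ggr' i.
  by split; [apply: submx_trans le1'|apply: submx_trans le2' _]; apply: submxMr.
Qed.

(** The rows of [h] are a new homogeneous basis with degrees [deg']; the first r of them are meant
    to span the subspace under study. The inverse [g] is kept so that [h *m y *m g] is the matrix of
    [y] in this basis. *)
Definition adapted N r s (deg : 'I_N -> J) (deg' : 'I_(r + s) -> J)
    (h : 'M[F]_(r + s, N)) (g : 'M[F]_(N, r + s)) : Prop :=
  [/\ h *m g = 1%:M, g *m h = 1%:M & preserves deg' deg h].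

End CoordinateRepresentations.

(** * Coordinates adapted to a graded subspace *)

Section AdaptedBasis.
Variables (F : fieldType) (J : choiceType) (N r s : nat).
Variables (deg : 'I_N -> J) (deg' : 'I_(r + s) -> J).
Variables (h : 'M[F]_(r + s, N)) (g : 'M[F]_(N, r + s)).
Hypothesis hgP : adapted deg deg' h g.

Local Notation uh := (usubmx h).
Local Notation dh := (dsubmx h).
Local Notation lg := (lsubmx g).
Local Notation rg := (rsubmx g).
Local Notation P i := (dmx F (fun t => deg t == i)).
Local Notation P1 i := (dmx F (fun t => deg' (lshift s t) == i)).
Local Notation P2 i := (dmx F (fun t => deg' (rshift r t) == i)).

Lemma adapted_inv : preserves deg deg' g.
Proof.
have [hg gh hdeg] := hgP; apply: comm_preserves => i.
rewrite -[RHS]mul1mx -gh -(mulmxA g h) (mulmxA h) (preserves_comm i hdeg).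
by rewrite -!mulmxA hg mulmx1.
Qed.

Lemma adapted_blocks :
  [/\ uh *m lg = 1%:M, uh *m rg = 0, dh *m lg = 0 & dh *m rg = 1%:M].
Proof.
have [hg _ _] := hgP; move: hg.
rewrite -[h in LHS]vsubmxK -[g in LHS]hsubmxK mul_col_row scalar_mx_block.
by move/eq_block_mx => [].
Qed.

Lemma adapted_split : lg *m uh + rg *m dh = 1%:M.
Proof.
have [_ gh _] := hgP; rewrite -gh -[h in RHS]vsubmxK -[g in RHS]hsubmxK.
by rewrite mul_row_col.
Qed.

(** The columns of [rg] are the coordinates along the complement, so the span of the first r basis
    vectors is their common kernel. *)
Lemma sub_usubmxE m (M : 'M[F]_(m, N)) : (M <= uh)%MS = (M *m rg == 0).
Proof.
have [_ ur _ _] := adapted_blocks; apply/idP/eqP => [/submxP[D ->]|M0].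
  by rewrite -mulmxA ur mulmx0.
rewrite -[M]mulmx1 -adapted_split mulmxDr [M *m (rg *m _)]mulmxA M0 mul0mx addr0.
by rewrite mulmxA submxMl.
Qed.

Lemma usubmx_free : row_free uh.
Proof. by have [? _ _ _] := adapted_blocks; apply/row_freeP; exists lg. Qed.

Lemma adapted_uh i : uh *m P i = P1 i *m uh.
Proof.
apply: preserves_comm => t u; rewrite mxE; have [_ _ hdeg] := hgP; exact: hdeg.
Qed.

Lemma adapted_lg i : lg *m P1 i = P i *m lg.
Proof. apply: preserves_comm => t u; rewrite mxE; exact: adapted_inv. Qed.

Lemma adapted_rg i : rg *m P2 i = P i *m rg.
Proof. apply: preserves_comm => t u; rewrite mxE; exact: adapted_inv. Qed.

Variable U : 'M[F]_N.
Hypothesis Uh : (U :=: uh)%MS.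

Lemma capmx_adapted i : (P i :&: U :=: P1 i *m uh)%MS.
Proof.
have [ul _ _ _] := adapted_blocks; apply/eqmxP/andP; split; last first.
  by rewrite sub_capmx Uh submxMl -adapted_uh submxMl.
set X := (_ :&: _)%MS; have XP : X *m P i = X.
  by apply/eqP; rewrite -sub_dmxE capmxSl.
have : (X <= uh)%MS by rewrite -Uh capmxSr.
rewrite sub_usubmxE => /eqP X0.
have XE : X = X *m lg *m uh.
  rewrite -[LHS]mulmx1 -adapted_split mulmxDr [X *m (rg *m _)]mulmxA X0 mul0mx addr0.
  by rewrite mulmxA.
by rewrite XE -{1}XP -[X *m _ *m lg]mulmxA -adapted_lg !mulmxA -mulmxA submxMl.
Qed.

Lemma rank_capmx_adapted i :
  \rank (P i :&: U)%MS = #|[pred t | deg' (lshift s t) == i]|.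
Proof.
rewrite capmx_adapted mxrankMfree ?usubmx_free // rank_dmx.
by apply: eq_card.
Qed.

Section Action.
Variables (y : 'M[F]_N).
Local Notation z := (h *m y *m g).
Let zE : z = block_mx (uh *m y *m lg) (uh *m y *m rg)
                      (dh *m y *m lg) (dh *m y *m rg).
Proof.
by rewrite -[h in LHS]vsubmxK -[g in LHS]hsubmxK mul_col_mx mul_col_row.
Qed.

Lemma stable_adapted : (U *m y <= U)%MS = (ursubmx z == 0).
Proof. by rewrite (eqmxMr _ Uh) Uh sub_usubmxE zE block_mxKur. Qed.

(** Matrices act on row vectors from the right, so stability of the span of the first r basis
    vectors is the vanishing of the upper right block. *)
Lemma subrep_adapted (a : dimvec J) :
  <<U>>%MS = U ->
  subrep a (V := crep deg y) U <->
  ursubmx z = 0 /\ forall i, #|[pred t | deg' (lshift s t) == i]| = a i.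
Proof.
move=> UU; split=> [[_ /= Uy _ ra]|[/eqP z0 ra]].
  by split=> [|i]; [apply/eqP; rewrite -stable_adapted|rewrite -rank_capmx_adapted ra].
split=> //=; first by rewrite stable_adapted.
- rewrite {1}Uh; apply/row_subP => t.
  have ta : deg' (lshift s t) \in finsupp a.
    rewrite mem_finsupp -ra -lt0n; apply/card_gt0P; exists t.
    by rewrite inE.
  apply: (sumsmx_seq_sup ta) => //; rewrite capmx_adapted.
  suff -> : row t uh = row t (P1 (deg' (lshift s t)) *m uh) by apply: row_sub.
  by apply/rowP => u; rewrite mxE [RHS]mxE dmx_mulE eqxx.
- by move=> i; rewrite rank_capmx_adapted.
Qed.

Hypothesis Uy : ursubmx z = 0.

(** The basis [row_base U] behind [restr] need not be homogeneous; [row_base U *m lg] is the change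
    from it to the first r rows of [h]. *)
Lemma iso_restr_adapted :
  iso (restr (V := crep deg y) U)
      (crep (fun t => deg' (lshift s t)) (ulsubmx z)).
Proof.
have [ul ur dl dr] := adapted_blocks.
have rbU : (row_base U :=: uh)%MS by apply: eqmx_trans Uh; apply: eq_row_base.
have rbfree : row_free (row_base U) by apply: row_base_free.
have rbK : row_base U *m lg *m uh = row_base U.
  have : (row_base U <= uh)%MS by rewrite rbU.
  rewrite sub_usubmxE => /eqP X0.
  rewrite -[RHS]mulmx1 -adapted_split mulmxDr [_ *m (rg *m _)]mulmxA X0 mul0mx addr0.
  by rewrite mulmxA.
have upK : uh *m pinvmx (row_base U) *m row_base U = uh.
  by rewrite mulmxKpV // rbU.
have z11 : ulsubmx z = uh *m y *m lg by rewrite zE block_mxKul.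
have KP m (M : 'M_(m, N)) : (M <= uh)%MS ->
    M *m pinvmx (row_base U) *m row_base U = M.
  by move=> Mu; rewrite mulmxKpV // rbU.
have rbV := mulmxVp rbfree.
rewrite /iso /=; move: (pinvmx (row_base U)) KP rbV upK => K.
move: (row_base U) rbU rbK {rbfree} => B rbU rbK KP rbV upK.
exists (B *m lg), (uh *m K); split=> /=.
- by rewrite mulmxA rbK.
- by rewrite mulmxA upK.
- rewrite z11 !mulmxA rbK KP //.
  rewrite (eqmxMr y rbU) sub_usubmxE.
  by move/eqP: Uy; rewrite zE block_mxKur.
- move=> i; rewrite !(eqmxMr _ (genmxE _)).
  have -> : (P i :&: U)%MS *m K *m (B *m lg) =
            (P i :&: U)%MS *m lg.
    by rewrite mulmxA KP // -Uh capmxSr.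
  rewrite (eqmxMr _ (capmx_adapted i)) -mulmxA ul mulmx1 submx_refl /=.
  by rewrite -[X in (X <= _)%MS]mulmx1 -ul mulmxA submxMr // capmx_adapted.
Qed.

Lemma iso_quo_adapted :
  iso (quo (V := crep deg y) U)
      (crep (fun t => deg' (rshift r t)) (drsubmx z)).
Proof.
have [ul ur dl dr] := adapted_blocks.
have z12 : uh *m y *m rg = 0 by move: Uy; rewrite zE block_mxKur.
set p := col_base (cokermx U).
have pfull : row_full p by apply: col_base_full.
have pp : pinvmx p *m p = 1%:M by apply: mulVpmx.
have kerp m (M : 'M_(m, N)) : (M *m p == 0) = (M *m rg == 0).
  rewrite -sub_usubmxE -Uh submxE -[in RHS](mulmx_base (cokermx U)) mulmxA.
  by rewrite [in RHS]mulmx_free_eq0 ?row_base_free.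
(* Both [p] and [rg] are surjections with kernel U, and [p *m pinvmx p] is the identity modulo U. *)
have prK : p *m pinvmx p *m rg = rg.
  apply/eqP; rewrite -subr_eq0 -{2}[rg]mul1mx -mulmxBl -kerp mulmxBl mul1mx.
  by rewrite -mulmxA pp mulmx1 subrr.
have up : uh *m p = 0 by apply/eqP; rewrite kerp ur.
have z22 : drsubmx z = dh *m y *m rg by rewrite zE block_mxKdr.
have rdE : rg *m dh = 1%:M - lg *m uh by rewrite -adapted_split addrAC subrr add0r.
rewrite /iso /= -/p; move: (pinvmx p) pp prK => K pp prK; clearbody p.
exists (K *m rg), (dh *m p); split=> /=.
- by rewrite mulmxA -[_ *m rg *m dh]mulmxA rdE mulmxBr mulmx1 mulmxBl pp
    -!mulmxA up !mulmx0 subr0.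
- by rewrite -mulmxA [p *m _]mulmxA prK.
- rewrite -[_ *m p *m (_ *m _)]mulmxA [p *m (_ *m _)]mulmxA prK z22 !mulmxA.
  rewrite -[_ *m rg *m dh]mulmxA rdE mulmxBr mulmx1 -!(mulmxA _ y rg) mulmxBl.
  by rewrite -[K *m (lg *m uh) *m _]mulmxA -(mulmxA lg) (mulmxA uh) z12 !mulmx0 subr0.
- move=> i; rewrite !(eqmxMr _ (genmxE _)).
  have -> : P i *m p *m (K *m rg) = rg *m P2 i.
    by rewrite -mulmxA (mulmxA p) prK adapted_rg.
  rewrite submxMl /= -[X in (X <= _)%MS]mul1mx -dr -mulmxA.
  exact: submxMl.
Qed.
End Action.

End AdaptedBasis.

(** A subspace stable under the degree projections is spanned by the homogeneous components of its
    vectors; a basis extracted from these is completed by standard basis vectors that give a basis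
    of the quotient. *)
Lemma graded_adapted (F : fieldType) (J : choiceType) N (deg : 'I_N -> J)
    (U : 'M[F]_N) :
  (forall i, U *m dmx F (fun t => (deg t == i)%B) <= U)%MS ->
  exists r s (deg' : 'I_(r + s) -> J) (h : 'M[F]_(r + s, N)) g,
    adapted deg deg' h g /\ (U :=: usubmx h)%MS.
Proof.
move=> Ugr; pose K := {: 'I_N * 'I_N}.
(* The rows of [A] are the homogeneous components of the rows of U; the second index serves only to
   name a degree. *)
pose A := \matrix_(k < #|K|) 
  row (enum_val k).1 (U *m dmx F (fun t => deg t == deg (enum_val k).2)).
have UA : (U :=: A)%MS.
  apply/eqmxP/andP; split; last first.
    apply/row_subP => k; rewrite rowK; apply: submx_trans (Ugr _); exact: row_sub.
  apply/row_subP => t.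
  rewrite -[U](dmx_sum_id (r := undup (codom deg)) (deg := deg)) ?undup_uniq //;
    last by move=> u; rewrite mem_undup codom_f.
  rewrite linear_sum /= big_seq_cond; apply: summx_sub => i.
  rewrite andbT mem_undup => /codomP[u ->].
  have -> : row t (U *m dmx F (fun t => deg t == deg u)) =
      row (enum_rank ((t, u) : K)) A by rewrite rowK enum_rankK.
  exact: row_sub.
pose p := col_base (cokermx U).
(* Rows are selected and never combined, so every row of [h] stays homogeneous. *)
pose f1 := maxrankfun A; pose f2 := maxrankfun p.
pose h := col_mx (rowsub f1 A) (rowsub f2 1%:M).
have kerp m (M : 'M_(m, N)) : (M *m p == 0) = (M <= U)%MS.
  by rewrite submxE -[in RHS](mulmx_base (cokermx U)) mulmxA
    [in RHS]mulmx_free_eq0 ?row_base_free.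
have Uh : (U <= h)%MS.
  by rewrite UA -(eq_maxrowsub A) -addsmxE addsmxSl.
have hfull : row_full h.
  rewrite -sub1mx.
  have /submxP[X XE] : ((1%:M : 'M_N) *m p <= rowsub f2 p)%MS.
    by rewrite submx_full // maxrowsub_full // col_base_full.
  rewrite -[1%:M](subrK (X *m rowsub f2 1%:M)) addmx_sub //.
    apply: submx_trans Uh; rewrite -kerp mulmxBl XE -mulmxA mul_rowsub_mx mul1mx.
    by rewrite subrr.
  by rewrite -addsmxE (submx_trans (submxMl _ _)) // addsmxSr.
have rsN : (\rank A + \rank p = N)%N.
  rewrite -UA; have /eqP -> : row_full p by apply: col_base_full.
  by rewrite mxrank_coker subnKC // rank_leq_row.
have hfree : row_free h by rewrite /row_free (eqP hfull) rsN.
pose deg' (t : 'I_(\rank A + \rank p)) := match split t with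
  inl k => deg (enum_val (f1 k)).2 | inr k => deg (f2 k) end.
exists (\rank A), (\rank p), deg', h, (pinvmx h); split; last first.
  by rewrite col_mxKu; apply: eqmx_trans UA (eqmx_sym (eq_maxrowsub A)).
split; [exact: mulmxVp|exact: mulVpmx|].
move=> t u; rewrite /h mxE /deg'; case: split => k; rewrite mxE; last first.
  by rewrite mxE; case: (f2 k =P u) => [->|]; rewrite ?eqxx.
rewrite /A mxE [row _ _ _ _]mxE mul_dmxE.
by case: (deg u =P _) => [->|]; rewrite ?eqxx.
Qed.

(** The third clause of [subrep] puts U inside the sum of its homogeneous parts; a degree projection
    fixes one of them and kills the others. *)
Lemma subrep_proj (F : fieldType) (J : choiceType) N (deg : 'I_N -> J)
    (y : 'M[F]_N) (a : dimvec J) (U : 'M[F]_N) i :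
  subrep a (V := crep deg y) U ->
  (U *m dmx F (fun t => (deg t == i)%B) <= U)%MS.
Proof.
case=> _ _ /= Ugr _; apply: submx_trans (submxMr _ Ugr) _.
rewrite submxE -mulmxA -sub_kermx; apply: sumsmx_seq_sub => j _ _.
rewrite sub_kermx mulmxA -submxE; set X := (_ :&: _)%MS.
have /eqP <- : X *m dmx F (fun t => deg t == j) == X.
  by rewrite -sub_dmxE capmxSl.
rewrite -mulmxA dmxM; have [->|ij] := eqVneq i j.
  rewrite (@eq_dmx _ _ _ (fun t => deg t == j)); last by move=> t /=; rewrite andbb.
  have /eqP -> : X *m dmx F (fun t => deg t == j) == X.
    by rewrite -sub_dmxE capmxSl.
  exact: capmxSr.
rewrite (@eq_dmx _ _ _ pred0); last first.
  by move=> t /=; case: eqP => // ->; rewrite eq_sym (negbTE ij).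
suff -> : dmx F (pred0 : pred 'I_N) = 0 by rewrite mulmx0 sub0mx.
by apply/matrixP => t u; rewrite !mxE mul0rn.
Qed.

(** * Degree patterns *)

Section Classes.
Variable n : nat.

Lemma cls_val k : (cls n k : nat)%:Z = (k %% n.+1%:Z)%Z.
Proof.
rewrite /cls inordK; first by rewrite gez0_abs ?modz_ge0.
by rewrite -ltz_nat gez0_abs ?modz_ge0 ?ltz_pmod.
Qed.

Lemma cls_eqE i j : (cls n i == cls n j) = (n.+1%:Z %| i - j)%Z.
Proof.
rewrite -eqz_mod_dvd -!cls_val; apply/eqP/eqP => [-> //|[]]; exact: val_inj.
Qed.

Lemma ordS_cls i : ordS (cls n i) = cls n (i + 1).
Proof.
apply: val_inj => /=.
apply/eqP; rewrite -eqz_nat -modz_nat cls_val -addn1 PoszD cls_val.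
by rewrite modzDml.
Qed.

(* The conditions on degrees i and j under which an entry from i to j may occur
   in a matrix raising degrees by at least k, and by e modulo n + 1. *)
Definition slot (k e i j : int) : bool :=
  (i + k <= j) && (n.+1%:Z %| j - i - e)%Z.

Section Pattern.
Variable F : fieldType.

Definition pat (k e : int) m p (deg : 'I_m -> int) (deg' : 'I_p -> int)
    (M : 'M[F]_(m, p)) : bool :=
  [forall t, forall u, (M t u != 0) ==> slot k e (deg t) (deg' u)].

Lemma patP k e m p (deg : 'I_m -> int) (deg' : 'I_p -> int) (M : 'M[F]_(m, p)) :
  reflect (forall t u, M t u != 0 -> slot k e (deg t) (deg' u))
          (pat k e deg deg' M).
Proof.
apply: (iffP forallP) => [MP t u|MP t]; last by apply/forallP => u; apply/implyP/MP.
by have /forallP/(_ u)/implyP := MP t.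
Qed.

(** Along a nonzero product of entries the shifts of degree add up, hence so do their lower bounds
    and their residues. *)
Lemma patM k1 e1 k2 e2 m p q (deg : 'I_m -> int) (deg' : 'I_p -> int)
    (deg'' : 'I_q -> int) (M : 'M[F]_(m, p)) (M' : 'M[F]_(p, q)) :
  pat k1 e1 deg deg' M -> pat k2 e2 deg' deg'' M' ->
  pat (k1 + k2) (e1 + e2) deg deg'' (M *m M').
Proof.
move=> /patP MP /patP MP'; apply/patP => t v; rewrite mxE => MM.
have [/existsP[u /andP[/MP/andP[le1 d1] /MP'/andP[le2 d2]]]|] :=
    boolP [exists u, (M t u != 0) && (M' u v != 0)].
  apply/andP; split; first by rewrite addrA; apply: le_trans le2; rewrite lerD2r.
  have -> : deg'' v - deg t - (e1 + e2) =
    (deg' u - deg t - e1) + (deg'' v - deg' u - e2) by lia.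
  exact: rpredD.
move/existsPn => MM0; case/eqP: MM; apply: big1 => u _.
by have := MM0 u; rewrite negb_and !negbK => /orP[]/eqP->; rewrite ?mul0r ?mulr0.
Qed.

Lemma patD k e m p (deg : 'I_m -> int) (deg' : 'I_p -> int) (M M' : 'M[F]_(m, p)) :
  pat k e deg deg' M -> pat k e deg deg' M' -> pat k e deg deg' (M + M').
Proof.
move=> /patP MP /patP MP'; apply/patP => t u; rewrite mxE => MM.
have [M0|/MP //] := eqVneq (M t u) 0; apply: MP'.
by rewrite M0 add0r in MM.
Qed.

Lemma patN k e m p (deg : 'I_m -> int) (deg' : 'I_p -> int) (M : 'M[F]_(m, p)) :
  pat k e deg deg' M -> pat k e deg deg' (- M).
Proof. by move=> /patP MP; apply/patP => t u; rewrite mxE oppr_eq0; apply: MP. Qed.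

Lemma pat0 k e m p (deg : 'I_m -> int) (deg' : 'I_p -> int) :
  pat k e deg deg' 0.
Proof. by apply/patP => t u; rewrite mxE eqxx. Qed.

Lemma patW k k' e m p (deg : 'I_m -> int) (deg' : 'I_p -> int) (M : 'M[F]_(m, p)) :
  k' <= k -> pat k e deg deg' M -> pat k' e deg deg' M.
Proof.
move=> kk' /patP MP; apply/patP => t u /MP /andP[le d]; apply/andP; split=> //.
by apply: le_trans le; rewrite lerD2l.
Qed.

Lemma pat_preserves m p (deg : 'I_m -> int) (deg' : 'I_p -> int) (M : 'M[F]_(m, p)) :
  preserves deg deg' M -> pat 0 0 deg deg' M.
Proof.
move=> MP; apply/patP => t u /MP ->.
by apply/andP; split; rewrite ?addr0 ?subr0 ?subrr ?dvdz0.
Qed.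

Lemma pat_1 m (deg : 'I_m -> int) : pat 0 0 deg deg 1%:M.
Proof.
by apply: pat_preserves => t u; rewrite mxE; case: (t =P u) => [->|]; rewrite ?eqxx.
Qed.

Lemma pat_exp m (deg : 'I_m -> int) k e (M : 'M[F]_m) j :
  pat k e deg deg M -> pat (k *+ j) (e *+ j) deg deg (M ^+ j).
Proof.
move=> MP; elim: j => [|j IHj]; first by rewrite !mulr0n expr0; apply: pat_1.
by rewrite !mulrS exprS; apply: patM MP IHj.
Qed.

Lemma pat_nilpotent m (deg : 'I_m -> int) e (M : 'M[F]_m) :
  pat 1 e deg deg M -> exists j, M ^+ j = 0.
Proof.
(* One more than the largest difference of degrees: a power that shifts by at least this much has no
   admissible entry. *)
move=> MP; exists (\max_(tu : 'I_m * 'I_m) `|deg tu.2 - deg tu.1|%N).+1.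
set B := \max_tu _; have /patP MB := pat_exp B.+1 MP.
apply/eqP/negPn/negP => /matrix0Pn[t [u /MB/andP[le _]]].
have leB : (`|deg u - deg t| <= B)%N by rewrite /B (bigD1 (t, u)) //= leq_maxl.
by move: le leB; rewrite natz; lia.
Qed.

Lemma pat_unipotent m (deg : 'I_m -> int) (M : 'M[F]_m) :
  pat 1 0 deg deg M ->
  exists2 Q : 'M[F]_m, Q *m (1%:M + M) = 1%:M & pat 0 0 deg deg Q.
Proof.
move=> MP; have [j Mj] := pat_nilpotent MP.
exists (\sum_(i < j) (- M) ^+ i).
  apply: mulmx1C; have := subrX1 (- M) j.
  rewrite exprNn Mj mulr0 sub0r => /(congr1 -%R).
  by rewrite opprK -mulNr opprB opprK => E; exact: esym E.
elim/big_rec: _ => [|i X _]; first exact: pat0.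
apply: patD; apply: (@patW (1 *+ i)); first by rewrite natz.
by have := pat_exp i (patN MP); rewrite mul0rn.
Qed.

End Pattern.
End Classes.

(** * The associated graded subspace *)

Section AssociatedGraded.
Variables (n : nat) (F : fieldType) (N : nat) (deg : 'I_N -> int).
Implicit Types U W : 'M[F]_N.

Local Notation Peq i := (dmx F (fun u => (deg u == i)%B)).
Local Notation Pge i := (dmx F (fun u => (i <= deg u)%R)).

(* The index t only serves to make deg t range over finitely many integers that
   include every degree where a component can be nonzero. *)
Definition grW W : 'M[F]_N :=
  <<(\sum_(t < N) (W :&: Pge (deg t))%MS *m Peq (deg t))%MS>>%MS.

Lemma dmxeqM i j : Peq j *m Peq i = if i == j then Peq i else 0.
Proof.
rewrite dmxM; have [->|ij] := eqVneq.
  by apply: eq_dmx => t /=; rewrite andbb.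
apply/matrixP => t u; rewrite !mxE /=; case: eqP => [->|]; rewrite ?mul0rn //=.
by rewrite eq_sym (negbTE ij) mul0rn.
Qed.

Lemma sub_grW W i : ((W :&: Pge i)%MS *m Peq i <= grW W)%MS.
Proof.
rewrite genmxE; have [/existsP[t /eqP <-]|/existsPn Ni] :=
    boolP [exists t, deg t == i].
  exact: (sumsmx_sup t).
suff -> : Peq i = 0 by rewrite mulmx0 sub0mx.
by apply/matrixP => t u; rewrite !mxE (negbTE (Ni t)) mul0rn.
Qed.

Lemma grW_comp W i : (grW W *m Peq i <= (W :&: Pge i)%MS *m Peq i)%MS.
Proof.
rewrite (eqmxMr _ (genmxE _)) submxE -mulmxA -sub_kermx.
apply/sumsmx_subP => t _; rewrite sub_kermx mulmxA -submxE -mulmxA dmxeqM.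
by case: eqP => [->|]; rewrite ?mulmx0 ?sub0mx.
Qed.

Lemma grW_proj W i : (grW W *m Peq i <= grW W)%MS.
Proof. exact: submx_trans (grW_comp W i) (sub_grW W i). Qed.

(** If w in W has leading component w_i, then w y lies in W and its component of degree i + 1 is w_i
    x, because y - x raises degrees by at least 2. *)
Lemma grW_stable (x y : 'M[F]_N) W :
  (forall t u, x t u != 0 -> deg u = deg t + 1) ->
  pat n 2 1 deg deg (y - x) ->
  (W *m y <= W)%MS -> (grW W *m x <= grW W)%MS.
Proof.
move=> xdeg /patP yx Wy; rewrite (eqmxMr _ (genmxE _)) submxE -mulmxA -sub_kermx.
apply/sumsmx_subP => t _; rewrite sub_kermx mulmxA -submxE.
set i := deg t; set X := (W :&: Pge i)%MS.
have XP v u : X v u != 0 -> i <= deg u.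
  by move: v u; apply/sub_dmxP; rewrite capmxSr.
have comm_x : x *m Peq (i + 1) = Peq i *m x.
  apply/matrixP => u v; rewrite mul_dmxE dmx_mulE.
  have [->|/xdeg ->] := eqVneq (x u v) 0; first by do 2 case: ifP.
  by rewrite (inj_eq (addIr _)).
have XyP : (X *m y <= Pge (i + 1))%MS.
  apply/sub_dmxP => u v; rewrite mxE => Xy.
  have [/existsP[w /andP[/XP le1 yw]]|] :=
      boolP [exists w, (X u w != 0) && (y w v != 0)].
    have [xw|/xdeg ->] := eqVneq (x w v) 0; last by rewrite lerD2r.
    have /yx/andP[le2 _] : (y - x) w v != 0 by rewrite !mxE xw subr0.
    lia.
  move/existsPn => MM0; case/eqP: Xy; apply: big1 => w _.
  by have := MM0 w; rewrite negb_and !negbK => /orP[]/eqP->; rewrite ?mul0r ?mulr0.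
have -> : X *m Peq i *m x = X *m y *m Peq (i + 1).
  rewrite -[y in RHS](subrK x) mulmxDr mulmxDl -[X *m x *m _]mulmxA comm_x mulmxA.
  rewrite -[LHS]add0r; congr (_ + _).
  apply/esym/matrixP => u v; rewrite mul_dmxE [RHS]mxE; case: eqP => // vi.
  rewrite mxE big1 // => w _; have [->|/XP le1] := eqVneq (X u w) 0.
    by rewrite mul0r.
  have [->|/yx/andP[le2 _]] := eqVneq ((y - x) w v) 0; first by rewrite mulr0.
  lia.
apply: submx_trans (sub_grW W (i + 1)); apply: submxMr.
by rewrite sub_capmx XyP andbT (submx_trans _ Wy) // submxMr // capmxSl.
Qed.

Section Fiber.
Variables (r s : nat) (deg' : 'I_(r + s) -> int).
Variables (h : 'M[F]_(r + s, N)) (g : 'M[F]_(N, r + s)).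
Hypothesis hgP : adapted deg deg' h g.
Local Notation uh := (usubmx h).
Local Notation dh := (dsubmx h).
Local Notation lg := (lsubmx g).
Local Notation rg := (rsubmx g).
Local Notation deg1 := (fun t => deg' (lshift s t)).
Local Notation deg2 := (fun t => deg' (rshift r t)).

(* The graph of a map T from U, spanned by the first r basis vectors, to its
   complement, spanned by the last s. *)
Definition graphmx (T : 'M[F]_(r, s)) : 'M[F]_N := <<row_mx 1%:M T *m h>>%MS.

Let row_h (T : 'M[F]_(r, s)) : row_mx 1%:M T *m h = uh + T *m dh.
Proof. by rewrite -[h in LHS]vsubmxK mul_row_col mul1mx. Qed.

Let uh_pat : preserves deg1 deg uh.
Proof. by have [_ _ hdeg] := hgP => t u; rewrite mxE; apply: hdeg. Qed.

Let dh_pat : preserves deg2 deg dh.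
Proof. by have [_ _ hdeg] := hgP => t u; rewrite mxE; apply: hdeg. Qed.

Let lg_pat : preserves deg deg1 lg.
Proof. by move=> t u; rewrite mxE; apply: (adapted_inv hgP). Qed.

Let rg_pat : preserves deg deg2 rg.
Proof. by move=> t u; rewrite mxE; apply: (adapted_inv hgP). Qed.

(** Since T raises degrees strictly, the complement part D T of a vector of degrees at least i lies
    in degrees above i, so the leading component is in U. Conversely a homogeneous u is the leading
    component of u + T u. *)
Lemma grW_graph T : pat n 1 0 deg1 deg2 T -> (grW (graphmx T) :=: uh)%MS.
Proof.
move=> TP; have [ul ur dl dr] := adapted_blocks hgP.
apply/eqmxP/andP; split.
  rewrite genmxE; apply/sumsmx_subP => t _; set i := deg t; set X := (_ :&: _)%MS.
  have XP v u : X v u != 0 -> i <= deg u.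
    by move: v u; apply/sub_dmxP; rewrite capmxSr.
  have /submxP[D XD] : (X <= (uh + T *m dh)%R)%MS.
    by rewrite -row_h -(genmxE (_ *m h)) capmxSl.
  have DE : X *m lg = D.
    by rewrite XD -mulmxA mulmxDl ul -mulmxA dl mulmx0 addr0 mulmx1.
  have XrE : X *m rg = D *m T.
    by rewrite XD -mulmxA mulmxDl ur -mulmxA dr mulmx1 add0r.
  rewrite (sub_usubmxE hgP) -mulmxA -(preserves_comm i rg_pat) mulmxA XrE.
  apply/eqP/matrixP => v u; rewrite mul_dmxE [RHS]mxE; case: eqP => // ui.
  rewrite mxE big1 // => w _; have [->|] := eqVneq (T w u) 0; first by rewrite mulr0.
  move/(elimT (patP _ _ _ _ _ _) TP) => /andP[le1 _].
  have [->|] := eqVneq (D v w) 0; first by rewrite mul0r.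
  rewrite -DE mxE => /eqP; case; apply: big1 => k _.
  have [->|/XP le2] := eqVneq (X v k) 0; first by rewrite mul0r.
  have [->|/lg_pat eq3] := eqVneq (lg k w) 0; first by rewrite mulr0.
  lia.
apply/row_subP => t; set i := deg1 t.
have TdP := patM TP (pat_preserves n dh_pat).
have -> : row t uh = row t (uh + T *m dh) *m Peq i.
  apply/rowP => u; rewrite mul_dmxE [row _ _ _ _]mxE [row _ _ _ _]mxE [in RHS]mxE.
  case: eqP => ui.
    have [->|/(elimT (patP _ _ _ _ _ _) TdP)/andP[le1 _]] := eqVneq ((T *m dh) t u) 0.
      by rewrite addr0.
    lia.
  by apply/eqP/negPn/negP => /uh_pat; rewrite -/i => E; rewrite E in ui.
apply: submx_trans (sub_grW (graphmx T) i); apply: submxMr.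
rewrite sub_capmx genmxE row_h row_sub /=.
apply/sub_dmxP => v u; rewrite mxE mxE.
have [->|/uh_pat <- //] := eqVneq (uh t u) 0.
rewrite add0r => /(elimT (patP _ _ _ _ _ _) TdP)/andP[]; rewrite -/i.
lia.
Qed.

(* A homogeneous basis of U lifts to vectors of W with higher-degree corrections;
   the corrections within U form a unipotent matrix, and inverting it puts the
   lifts in the form u + T u. *)
Lemma graph_of_grW W :
  (forall c, W *m dmx F (fun u => (cls n (deg u) == c)%B) <= W)%MS ->
  (grW W :=: uh)%MS -> <<W>>%MS = W ->
  exists2 T, pat n 1 0 deg1 deg2 T & W = graphmx T.
Proof.
move=> Wcls gW WW; have [ul ur dl dr] := adapted_blocks hgP.
have ghs := adapted_split hgP.
have liftP (t : 'I_r) : exists w : 'rV[F]_N, [/\ (w <= W)%MS,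
    forall u, w 0 u != 0 -> slot n 0 0 (deg1 t) (deg u) &
    forall u, deg u = deg1 t -> w 0 u = uh t u].
  set i := deg1 t.
  have uhE : row t uh *m Peq i = row t uh.
    by apply: dmx_id => v u; rewrite mxE => /uh_pat <-.
  have : (row t uh *m Peq i <= (W :&: Pge i)%MS *m Peq i)%MS.
    by apply: submx_trans (grW_comp W i); rewrite submxMr // gW row_sub.
  rewrite uhE => /submxP[D DE]; set X := (_ :&: _)%MS in DE.
  have XP : (D *m X <= Pge i)%MS by rewrite mulmx_sub // capmxSr.
  (* The lift is cut down to the residue class of its leading degree. It stays in W because W is
     graded modulo the period. *)
  exists (D *m X *m dmx F (fun u => cls n (deg u) == cls n i)); split.
  - by apply: submx_trans (Wcls (cls n i)); rewrite submxMr // mulmx_sub // capmxSl.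
  - move=> u; rewrite mul_dmxE; case: ifP => [ui|]; last by rewrite eqxx.
    move/(elimT (sub_dmxP _ _) XP) => le; apply/andP; rewrite addr0 subr0.
    by rewrite -cls_eqE.
  - move=> u ui; rewrite mul_dmxE ui eqxx.
    have := congr1 (fun M : 'rV_N => M 0 u) DE.
    by rewrite mulmxA mul_dmxE ui eqxx => <-; rewrite mxE.
have [w /all_and3[wW wslot wh]] := fin_all_exists liftP.
pose L := \matrix_t w t; pose R := L - uh.
have LW : (L <= W)%MS by apply/row_subP => t; rewrite rowK.
have RP : pat n 1 0 deg1 deg R.
  apply/patP => t u; rewrite 2!mxE [(- uh) t u]mxE => Rtu.
  have [E|ui] := eqVneq (deg u) (deg1 t); first by rewrite wh // subrr eqxx in Rtu.
  have uh0 : uh t u = 0 by apply/eqP/negPn/negP => /uh_pat E; rewrite E eqxx in ui.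
  have /wslot/andP[le d] : w t 0 u != 0 by rewrite uh0 subr0 in Rtu.
  by apply/andP; split=> //; lia.
have [Q QE QP] := pat_unipotent (patM RP (pat_preserves n lg_pat)).
pose T := Q *m (R *m rg).
have TP : pat n 1 0 deg1 deg2 T by apply: patM QP (patM RP (pat_preserves n rg_pat)).
have Llg : L *m lg = 1%:M + R *m lg by rewrite -ul -mulmxDl addrC subrK.
have Lrg : L *m rg = R *m rg by rewrite mulmxBl ur subr0.
have TE : row_mx 1%:M T *m h = Q *m L.
  rewrite -[in RHS](mulmx1 L) -ghs mulmxDr [L *m _]mulmxA Llg.
  by rewrite [L *m _]mulmxA Lrg mulmxDr mulmxA QE mul1mx mulmxA row_h.
exists T => //; rewrite -WW; apply/eq_genmx/eqmxP/andP; split; last first.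
  by rewrite TE mulmx_sub.
pose X := W - W *m lg *m (row_mx 1%:M T *m h).
have XW : (X <= W)%MS.
  by rewrite addmx_sub // -mulNmx TE; do 2 apply: mulmx_sub.
have Xlg : X *m lg = 0.
  rewrite mulmxBl row_h -[_ *m _ *m lg]mulmxA mulmxDl ul -[T *m _ *m _]mulmxA dl.
  by rewrite mulmx0 addr0 mulmx1 subrr.
suff X0 : X = 0 by rewrite -[W]subr0 -X0 opprB addrC subrK submxMl.
(* The rows of [X] lie in W and have no U-coordinates. A nonzero row would have a nonzero leading
   component, which lies in [grW W], hence in U, and still has no U-coordinates. *)
apply/eqP/negPn/negP => /matrix0Pn[v [u0 Xvu0]].
have [u Xvu umin] := @arg_minP _ _ _ u0 (fun u => X v u != 0) deg Xvu0.
set i := deg u in umin.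
have : (row v X *m Peq i <= uh)%MS.
  rewrite -gW; apply: submx_trans (sub_grW W i); rewrite submxMr // sub_capmx.
  rewrite (submx_trans (row_sub _ _) XW) /=.
  by apply/sub_dmxP => k l; rewrite mxE => /umin.
rewrite (sub_usubmxE hgP) => /eqP rg0.
have /matrixP/(_ 0 u) : row v X *m Peq i = 0.
  rewrite -[LHS]mulmx1 -ghs mulmxDr [_ *m (rg *m dh)]mulmxA rg0 mul0mx addr0.
  rewrite mulmxA -[_ *m _ *m lg]mulmxA -(preserves_comm i lg_pat) mulmxA.
  by rewrite -row_mul Xlg row0 !mul0mx.
by rewrite mul_dmxE eqxx mxE [RHS]mxE => /eqP; rewrite (negbTE Xvu).
Qed.

End Fiber.

End AssociatedGraded.

(** * Summing over a fiber of the associated graded map *)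

Section Counting.
Variables (F : finFieldType) (m p : nat).

Lemma card_mx_support (S : 'I_m -> 'I_p -> bool) :
  #|[pred M : 'M[F]_(m, p) | [forall t, forall u, (M t u != 0) ==> S t u]]| =
  (#|F| ^ #|[pred tu : 'I_m * 'I_p | S tu.1 tu.2]|)%N.
Proof.
pose f (M : 'M[F]_(m, p)) := [ffun tu : 'I_m * 'I_p => M tu.1 tu.2].
have finj : injective f.
  move=> M M' /ffunP E; apply/matrixP => t u.
  by have := E (t, u); rewrite !ffunE.
rewrite -(card_pffun_on (0 : F)) -(card_image finj); apply: eq_card => k.
apply/fintype.imageP/pffun_onP => [[M]|[/supportP ks _]].
  rewrite inE => /forallP MS ->; split=> [|t _ //].
  apply/supportP => -[t u] Stu; rewrite ffunE /=.
  apply/eqP/negPn/negP => Mtu; case/negP: Stu.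
  by have /forallP/(_ u)/implyP/(_ Mtu) := MS t.
exists (\matrix_(t, u) k (t, u)); last by apply/ffunP => -[t u]; rewrite ffunE mxE.
apply/forallP => t; apply/forallP => u; rewrite mxE; apply/implyP.
by apply: contraR => Stu; apply/eqP/ks; rewrite inE.
Qed.

End Counting.

Section FiberSum.
Variables (n : nat) (F : finFieldType) (C : comNzRingType).
Variables (N : nat) (deg : 'I_N -> int) (x : 'M[F]_N).
Hypothesis xdeg : forall t u, x t u != 0 -> deg u = deg t + 1.
Variables phi psi : grep F 'I_n.+1 -> C.
Hypothesis phi_iso : forall V W, iso V W -> phi V = phi W.
Hypothesis psi_iso : forall V W, iso V W -> psi V = psi W.
Variables (r s : nat) (deg' : 'I_(r + s) -> int).
Variables (h : 'M[F]_(r + s, N)) (g : 'M[F]_(N, r + s)).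
Hypothesis hgP : adapted deg deg' h g.
Variable U : 'M[F]_N.
Hypothesis Uh : (U :=: usubmx h)%MS.
Hypothesis UU : <<U>>%MS = U.
Hypothesis Ux : ursubmx (h *m x *m g) = 0.
Local Notation cdeg := (fun t => cls n (deg t)).
Local Notation deg1 := (fun t => deg' (lshift s t)).
Local Notation deg2 := (fun t => deg' (rshift r t)).
Local Notation x' := (h *m x *m g).

Let Tx (T : 'M[F]_(r, s)) : 'M[F]_(r + s) := block_mx 1%:M T 0 1%:M.
Let tau (T : 'M[F]_(r, s)) : 'M[F]_(r + s) := block_mx 0 T 0 0.

Let TxE T : Tx T = 1%:M + tau T.
Proof. by rewrite scalar_mx_block add_block_mx !addr0 add0r. Qed.

Let TxK T : Tx T *m Tx (- T) = 1%:M.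
Proof.
rewrite mulmx_block !mul1mx !mul0mx !mulmx0 !mulmx1 !addr0 add0r addrC subrr.
by rewrite -scalar_mx_block.
Qed.

Let TxVK T : Tx (- T) *m Tx T = 1%:M.
Proof. by rewrite -{2}[T]opprK TxK. Qed.

Let tau_pat T : pat n 1 0 deg1 deg2 T -> pat n 1 0 deg' deg' (tau T).
Proof.
move=> /patP TP; apply/patP => t u; rewrite /tau.
case: (split_ordP t) => t' ->; case: (split_ordP u) => u' ->.
- by rewrite block_mxEul mxE eqxx.
- by rewrite block_mxEur => /TP.
- by rewrite block_mxEdl mxE eqxx.
- by rewrite block_mxEdr mxE eqxx.
Qed.

Let h_pat : pat n 0 0 deg' deg h.
Proof. by have [_ _ hdeg] := hgP; apply: pat_preserves. Qed.
Let g_pat : pat n 0 0 deg deg' g.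
Proof. by apply: pat_preserves; apply: adapted_inv hgP. Qed.

Let pat_sandwich m1 m2 m3 m4 (d1 : 'I_m1 -> int) (d2 : 'I_m2 -> int)
    (d3 : 'I_m3 -> int) (d4 : 'I_m4 -> int) k e
    (A : 'M[F]_(m1, m2)) (M : 'M[F]_(m2, m3)) (B : 'M[F]_(m3, m4)) :
  pat n 0 0 d1 d2 A -> pat n 0 0 d3 d4 B -> pat n k e d2 d3 M ->
  pat n k e d1 d4 (A *m M *m B).
Proof. by move=> AP BP MP; have := patM (patM AP MP) BP; rewrite !add0r !addr0. Qed.

Let x'_pat : pat n 1 1 deg' deg' x'.
Proof.
apply: pat_sandwich h_pat g_pat _; apply/patP => t u /xdeg ->.
rewrite /slot lexx /=; have -> : deg t + 1 - deg t - 1 = 0 by lia.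
exact: dvdz0.
Qed.

(** Every correction term contains [tau T], with parameters (1, 0), and exactly one factor [z], with
    (1, 1); so it shifts by at least 2 with residue 1. *)
Let pat_conj T z : pat n 1 0 deg1 deg2 T ->
  pat n 2 1 deg' deg' (z - x') -> pat n 2 1 deg' deg' (Tx (- T) *m z *m Tx T - x').
Proof.
move=> TP zP; have tP := tau_pat TP.
have zP1 : pat n 1 1 deg' deg' z.
  by rewrite -[z](subrK x'); apply: patD x'_pat; apply: patW zP.
have -> : Tx (- T) *m z *m Tx T - x' =
    (z - x') + z *m tau T - tau T *m z - tau T *m z *m tau T.
  have -> : Tx (- T) = 1%:M - tau T.
    by rewrite TxE /tau opp_block_mx !oppr0.
  rewrite TxE mulmxBl mul1mx mulmxDr mulmx1 mulmxBl.
  by rewrite [LHS](AC ((2*2)*1) (1*5*3*2*4)).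
apply: patD; first apply: patD; first apply: patD => //.
- exact: patM zP1 tP.
- by apply: patN; apply: patM tP zP1.
- apply: patN; apply: (@patW _ _ 3); first by [].
  exact: patM (patM tP zP1) tP.
Qed.

Let hT T := Tx T *m h.
Let gT T := g *m Tx (- T).

Let hTgT T : hT T *m gT T = 1%:M.
Proof.
have [hg gh _] := hgP.
by rewrite /hT /gT -mulmxA (mulmxA h) hg mul1mx TxK.
Qed.

Let gThT T : gT T *m hT T = 1%:M.
Proof.
have [hg gh _] := hgP.
by rewrite /hT /gT -mulmxA (mulmxA (Tx _)) TxVK mul1mx gh.
Qed.

(** The map 1 + T breaks the integer grading but keeps classes, so the new basis is adapted only for
    the cyclic grading, as W requires. *)
Let hT_adapted T : pat n 1 0 deg1 deg2 T ->
  adapted cdeg (fun t => cls n (deg' t)) (hT T) (gT T).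
Proof.
move=> TP; split=> // t u hTtu.
have : pat n 0 0 deg' deg (hT T).
  have TxP : pat n 0 0 deg' deg' (Tx T).
    by rewrite TxE; apply: patD; [apply: pat_1|apply: patW (tau_pat TP)].
  exact: patM TxP h_pat.
move=> /patP/(_ _ _ hTtu)/andP[_]; rewrite subr0 -cls_eqE => /eqP->.
by [].
Qed.

Let graphE T : (graphmx h T :=: usubmx (hT T))%MS.
Proof.
apply: eqmx_trans (genmxE _) _.
rewrite /hT /Tx block_mxEv mul_col_mx col_mxKu; exact: eqmx_refl.
Qed.

Let graph_inj : injective (graphmx h).
Proof.
move=> T T' E; have [ul ur dl dr] := adapted_blocks hgP.
have rowE X : row_mx 1%:M X *m h = usubmx h + X *m dsubmx h.
  by rewrite -[h in LHS]vsubmxK mul_row_col mul1mx.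
have : (row_mx 1%:M T *m h <= row_mx 1%:M T' *m h)%MS.
  by rewrite -(genmxE (_ T *m h)) -/(graphmx h T) E genmxE.
case/submxP => D; rewrite !rowE => DE.
have := congr1 (mulmx^~ (lsubmx g)) DE; have := congr1 (mulmx^~ (rsubmx g)) DE.
rewrite !(mulmxDl, mulmxDr) -!mulmxA ul ur dl dr !mulmx0 !mulmx1 !addr0 !add0r.
by move=> -> <-; rewrite mul1mx.
Qed.

Variable alpha : dimvec 'I_n.+1.

(** W is a graph over U whose basis vectors keep the classes of those of U, so the cyclic dimension
    of W can be read off U. *)
Lemma subrep_cls_dim (y W : 'M[F]_N) :
  subrep alpha (V := crep cdeg y) W -> grW deg W = U ->
  forall c, #|[pred t : 'I_r | cls n (deg' (lshift s t)) == c]| = alpha c.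
Proof.
move=> sW gW; have WW : <<W>>%MS = W by case: sW.
have [c||//|T TP WE] := graph_of_grW hgP (n := n) (W := W).
- exact: subrep_proj sW.
- by rewrite gW.
rewrite WE in sW WW.
by have /(_ sW)[] := (subrep_adapted (hT_adapted TP) (@graphE T) y alpha WW).1.
Qed.

Hypothesis alphaE :
  forall c, #|[pred t : 'I_r | cls n (deg' (lshift s t)) == c]| = alpha c.

(* Conjugating y by the unipotent 1 + T moves the graph of T to U itself and keeps
   the associated graded of y, so the sum over W only contributes the number of
   T; the off-diagonal block of a y stabilizing U is then free. *)
Lemma fiber_sum :
  \sum_(y : 'M[F]_N | pat n 2 1 deg deg (y - x))
    \sum_(W : 'M[F]_N |
        `[< subrep alpha (V := crep cdeg y) W >] && (grW deg W == U))
      phi (restr (V := crep cdeg y) W) * psi (quo (V := crep cdeg y) W) =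
  (#|[pred T : 'M[F]_(r, s) | pat n 1 0 deg1 deg2 T]| *
   #|[pred T : 'M[F]_(s, r) | pat n 2 1 deg2 deg1 T]|)%:R *
  (\sum_(z : 'M[F]_r | pat n 2 1 deg1 deg1 (z - ulsubmx x'))
      phi (crep (fun t => cls n (deg1 t)) z)) *
  (\sum_(z : 'M[F]_s | pat n 2 1 deg2 deg2 (z - drsubmx x'))
      psi (crep (fun t => cls n (deg2 t)) z)).
Proof.
pose PT (T : 'M[F]_(r, s)) := pat n 1 0 deg1 deg2 T.
(* The reindexing needs a total inverse of [graphmx h]; away from graphs it takes the value 0. *)
pose tinv W : 'M[F]_(r, s) := odflt 0 [pick T | PT T && (graphmx h T == W)].
have tinvP W : (exists2 T, PT T & W = graphmx h T) ->
    PT (tinv W) /\ graphmx h (tinv W) = W.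
  case=> T TP WE; rewrite /tinv; case: pickP => [T' /andP[T'P /eqP //]|/(_ T)].
  by rewrite TP WE eqxx.
pose G (z : 'M[F]_(r + s)) := phi (crep (fun t => cls n (deg1 t)) (ulsubmx z)) *
  psi (crep (fun t => cls n (deg2 t)) (drsubmx z)).
have step1 y : 
  \sum_(W : 'M[F]_N |
        `[< subrep alpha (V := crep cdeg y) W >] && (grW deg W == U))
      phi (restr (V := crep cdeg y) W) * psi (quo (V := crep cdeg y) W) =
  \sum_(T | PT T && (ursubmx (hT T *m y *m gT T) == 0)) G (hT T *m y *m gT T).
  have exT W : subrep alpha (V := crep cdeg y) W -> grW deg W = U ->
      exists2 T, PT T & W = graphmx h T.
    move=> sW gW; apply: (graph_of_grW hgP) => [c||].
    - exact: subrep_proj sW.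
    - by rewrite gW.
    - by case: sW.
  rewrite (reindex_onto (graphmx h) tinv) /=; last first.
    move=> W /andP[/asboolP sW /eqP gW].
    by have [] := tinvP W (exT W sW gW).
  have subE T : PT T -> `[< subrep alpha (V := crep cdeg y) (graphmx h T) >] =
      (ursubmx (hT T *m y *m gT T) == 0).
    move=> TP; apply/asboolP/eqP => [|z0].
      case/(subrep_adapted (hT_adapted TP) (@graphE T)) => //.
      by rewrite genmx_id.
    apply/(subrep_adapted (hT_adapted TP) (@graphE T)); first by rewrite genmx_id.
    by split.
  apply: eq_big => [T|T].
    apply/andP/andP => [[/andP[/asboolP sW /eqP gW] /eqP tT]|[TP z0]].
      have [TP _] := tinvP _ (exT _ sW gW); rewrite tT in TP.
      by split=> //; rewrite -subE //; apply/asboolP.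
    rewrite subE // z0 /=; split.
      apply/eqP; rewrite -UU -[LHS]genmx_id; apply/eq_genmx.
      by apply: eqmx_trans (eqmx_sym Uh); apply: grW_graph hgP _ TP.
    have [_ E] := tinvP (graphmx h T) (ex_intro2 _ _ T TP erefl).
    by apply/eqP/graph_inj.
  move=> /andP[/andP[/asboolP sW /eqP gW] /eqP tT].
  have [TP _] := tinvP _ (exT _ sW gW); rewrite tT in TP.
  have z0 : ursubmx (hT T *m y *m gT T) = 0.
    by apply/eqP; rewrite -subE //; apply/asboolP.
  congr (_ * _).
    exact: phi_iso (iso_restr_adapted (hT_adapted TP) (@graphE T) z0).
  exact: psi_iso (iso_quo_adapted (hT_adapted TP) (@graphE T) z0).
under eq_bigr => y _ do rewrite step1.
rewrite (exchange_big_dep PT) /=; last by move=> y T _ /andP[].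
pose H := \sum_(z : 'M[F]_(r + s) | pat n 2 1 deg' deg' (z - x') && (ursubmx z == 0))
  G z.
(* Writing y in the basis [hT T] turns the fiber over x into the fiber over [x'], by [pat_conj], so
   the inner sum does not depend on T. *)
have step2 T : PT T ->
  \sum_(y | pat n 2 1 deg deg (y - x) &&
     (PT T && (ursubmx (hT T *m y *m gT T) == 0))) G (hT T *m y *m gT T) = H.
  move=> TP; have [hg gh _] := hgP.
  rewrite (reindex_onto (fun z => gT T *m z *m hT T) (fun y => hT T *m y *m gT T)) /=.
    have zK z : hT T *m (gT T *m z *m hT T) *m gT T = z.
      by rewrite -(mulmxA (gT T)) (mulmxA (hT T)) hTgT mul1mx -(mulmxA z) hTgT mulmx1.
    apply: eq_big => [z|z _]; last by rewrite zK.
    rewrite zK eqxx andbT TP /=; congr (_ && _).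
    have xE : x = g *m x' *m h by rewrite !mulmxA gh mul1mx -mulmxA gh mulmx1.
    apply/idP/idP => [yP|zP].
      have zP : pat n 2 1 deg' deg' (h *m (gT T *m z *m hT T) *m g - x').
        by rewrite -mulmxBl -mulmxBr; apply: pat_sandwich h_pat g_pat yP.
      have := @pat_conj (- T) _ (patN TP) zP; rewrite opprK /hT /gT.
      rewrite !mulmxA -[Tx T *m h *m g]mulmxA hg mulmx1 TxK mul1mx.
      by rewrite -[_ *m h *m g]mulmxA hg mulmx1 -mulmxA TxK mulmx1.
    have := pat_sandwich g_pat h_pat (pat_conj TP zP).
    by rewrite mulmxBr mulmxBl -xE /gT /hT !mulmxA.
  move=> y _; rewrite -(mulmxA (hT T)) (mulmxA (gT T)) gThT mul1mx.
  by rewrite -(mulmxA y) gThT mulmx1.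
rewrite (eq_bigr (fun=> H)) => [|T TP]; last exact: step2.
rewrite sumr_const.
(* The upper right block vanishes for z by stability of U under y, and for [x'] by stability under
   x; the other three blocks vary independently. *)
have pat_block z11 z21 z22 :
    pat n 2 1 deg' deg' (block_mx z11 0 z21 z22 - x') =
    [&& pat n 2 1 deg1 deg1 (z11 - ulsubmx x'),
        pat n 2 1 deg2 deg2 (z22 - drsubmx x') &
        pat n 2 1 deg2 deg1 (z21 - dlsubmx x')].
  rewrite -[x' in LHS]submxK Ux opp_block_mx add_block_mx subr0.
  apply/patP/and3P => [zP|[/patP P1 /patP P2 /patP P3] t u].
    split; apply/patP => t u ztu.
    - by have := zP (lshift s t) (lshift s u); rewrite block_mxEul; apply.
    - by have := zP (rshift r t) (rshift r u); rewrite block_mxEdr; apply.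
    - by have := zP (rshift r t) (lshift s u); rewrite block_mxEdl; apply.
  case: (split_ordP t) => t' ->; case: (split_ordP u) => u' ->.
  - by rewrite block_mxEul => /P1.
  - by rewrite block_mxEur mxE eqxx.
  - by rewrite block_mxEdl => /P3.
  - by rewrite block_mxEdr => /P2.
have -> : H = \sum_(z11 | pat n 2 1 deg1 deg1 (z11 - ulsubmx x'))
    \sum_(z22 | pat n 2 1 deg2 deg2 (z22 - drsubmx x'))
      \sum_(z21 | pat n 2 1 deg2 deg1 (z21 - dlsubmx x'))
         (phi (crep (fun t => cls n (deg1 t)) z11) *
          psi (crep (fun t => cls n (deg2 t)) z22)).
  under [RHS]eq_bigr => z11 _ do rewrite pair_big.
  rewrite pair_big /= /H.
  rewrite (reindex_onto (fun p : 'M[F]_r * ('M[F]_s * 'M[F]_(s, r)) =>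
             block_mx p.1 0 p.2.2 p.2.1)
           (fun z => (ulsubmx z, (drsubmx z, dlsubmx z)))) /=.
    apply: eq_big => [[z11 [z22 z21]]|[z11 [z22 z21]] _] /=.
      by rewrite pat_block block_mxKur block_mxKul block_mxKdl block_mxKdr !eqxx !andbT.
    by rewrite /G block_mxKul block_mxKdr.
  by move=> z /andP[_ /eqP <-]; rewrite submxK.
(* The lower left block ranges over a translate of a vector space of matrices, and the summand does
   not depend on it. *)
have cardE : #|[pred T : 'M[F]_(s, r) | pat n 2 1 deg2 deg1 (T - dlsubmx x')]| =
             #|[pred T : 'M[F]_(s, r) | pat n 2 1 deg2 deg1 T]|.
  rewrite -!sum1_card (reindex_inj (addIr (dlsubmx x'))).
  by apply: eq_bigl => T; rewrite !inE addrK.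
set k := #|[pred T : 'M[F]_(s, r) | pat n 2 1 deg2 deg1 T]| in cardE *.
rewrite (eq_bigr (fun z11 => (\sum_(z22 | pat n 2 1 deg2 deg2 (z22 - drsubmx x'))
    (phi (crep (fun t => cls n (deg1 t)) z11) *
     psi (crep (fun t => cls n (deg2 t)) z22))) *+ k)); last first.
  by move=> z11 _; rewrite -sumrMnl; apply: eq_bigr => z22 _; rewrite sumr_const -cardE.
rewrite sumrMnl -mulrnA -mulrA big_distrlr /= [RHS]mulr_natl.
by rewrite mulnC.
Qed.

End FiberSum.

(** * Exponents *)

Section Exponents.

Lemma Posz_sum (K : Type) (rs : seq K) (P : pred K) (f : K -> nat) :
  (\sum_(k <- rs | P k) f k)%N%:Z = \sum_(k <- rs | P k) (f k)%:Z.
Proof. exact: (big_morph Posz PoszD). Qed.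

Lemma card_Posz (K : finType) (P : pred K) : #|P|%:Z = \sum_k (P k : nat)%:Z.
Proof.
rewrite -sum1_card big_mkcond /= Posz_sum; apply: eq_bigr => k _.
by rewrite unfold_in; case: (P k).
Qed.

(** On S the function [G] is the push-forward of the weight [c] along [f]. It vanishes outside the
    finite image of [f], so its sum over S collects [c] over the preimage of S. *)
Lemma fsbig_count (I : choiceType) (K : finType) (S : set I) (f : K -> I)
    (c : K -> int) (G : I -> int) :
  (forall p, S p -> G p = \sum_k (p == f k : nat)%:Z * c k) ->
  \sum_(p \in S) G p = \sum_k (f k \in S : nat)%:Z * c k.
Proof.
move=> GE; pose rs := undup [seq f k | k <- enum K & f k \in S].
have frs k : (f k \in rs) = (f k \in S).
  rewrite mem_undup; apply/mapP/idP => [[k' + ->]|fS].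
    by rewrite mem_filter => /andP[].
  by exists k => //; rewrite mem_filter fS mem_enum.
have rsS p : p \in rs -> S p.
  rewrite mem_undup => /mapP[k + ->]; rewrite mem_filter => /andP[fS _].
  by rewrite inE in fS.
rewrite (@fsbigE _ _ _ _ _ rs) ?undup_uniq //; last first.
  move=> p Sp prs; rewrite GE // big1 // => k _.
  case: eqP => [pk|]; last by rewrite mul0r.
  by rewrite pk frs -pk mem_set in prs.
transitivity (\sum_(p <- rs) \sum_k (p == f k : nat)%:Z * c k).
  rewrite big_seq_cond [RHS]big_seq; apply: eq_big => [p|p /andP[prs _]].
    by case prs : (p \in rs) => //=; rewrite mem_set //; apply: rsS.
  by apply: GE; apply: rsS.
rewrite exchange_big; apply: eq_bigr => k _ /=.
transitivity ((\sum_(p <- rs) (p == f k : nat)%:Z) * c k).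
  by rewrite mulr_suml.
congr (_ * _).
rewrite -frs; have [frk|frk] := boolP (f k \in rs).
  rewrite (bigD1_seq (f k)) ?undup_uniq //= eqxx big1 ?addr0 //.
  by move=> p /negbTE->.
rewrite big_seq big1 // => p prs; case: eqP => // pk.
by rewrite -pk prs in frk.
Qed.

Lemma dim_degE (I : choiceType) m (deg : 'I_m -> I) (d : dimvec I) i :
  (forall i, #|[pred t | deg t == i]| = d i) ->
  (d i)%:Z = \sum_t (deg t == i : nat)%:Z.
Proof. by move=> <-; rewrite card_Posz. Qed.

(** The product of d_i and d_(j+1) counts the pairs with [deg t = i] and [deg u - 1 = j], and i < j
    becomes a shift of at least 2. Hence h(d) is the dimension of the fibers of p minus that of the
    class-preserving endomorphisms that raise degrees strictly. *)
Lemma hformE n m (deg : 'I_m -> int) (d : dimvec int) :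
  (forall i, #|[pred t | deg t == i]| = d i) ->
  hform n d = \sum_t \sum_u ((slot n 2 1 (deg t) (deg u) : nat)%:Z -
                             (slot n 1 0 (deg t) (deg u) : nat)%:Z).
Proof.
move=> dE; rewrite /hform.
(* The boolean separates the term with d_(j+1) from the term with d_j, which has weight -1. *)
rewrite (@fsbig_count _ ('I_m * 'I_m * bool)%type _
   (fun k => (deg k.1.1, if k.2 then deg k.1.2 - 1 else deg k.1.2))
   (fun k => if k.2 then 1 else -1)).
  rewrite pair_big /= -(pair_big predT predT (fun tu b =>
    (((deg tu.1, if b then deg tu.2 - 1 else deg tu.2) \in
     [set p : int * int | p.1 < p.2 /\ cls n p.1 = cls n p.2]%classic) : nat)%:Z *
       (if b then 1 else -1))) /=.
  apply: eq_bigr => -[t u] _; rewrite big_bool /= mulr1 mulrN1; congr (_%:Z - _%:Z).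
    congr nat_of_bool; apply/idP/andP; rewrite inE /=.
      move=> [lt /eqP]; rewrite eq_sym cls_eqE => dv; split; first lia.
      by rewrite addrAC.
    move=> [lt dv]; split; first lia.
    by apply/eqP; rewrite eq_sym cls_eqE addrAC.
  congr nat_of_bool; apply/idP/andP; rewrite inE /=.
    move=> [lt /eqP]; rewrite eq_sym cls_eqE => dv; split; first lia.
    by rewrite subr0.
  move=> [lt dv]; split; first lia.
  by apply/eqP; rewrite eq_sym cls_eqE; rewrite subr0 in dv.
move=> [i j] _ /=; rewrite !(dim_degE _ dE) -sumrB big_distrlr /= pair_big /=.
rewrite -(pair_big predT predT (fun tu b =>
    ((i, j) == (deg tu.1, if b then deg tu.2 - 1 else deg tu.2) : nat)%:Z *
       (if b then 1 else -1))) /=.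
apply: eq_bigr => -[t u] _; rewrite big_bool /= !xpair_eqE mulr1 mulrN1.
rewrite [deg t == i]eq_sym; case: (i == deg t); rewrite ?mul0r //= mul1r.
by congr (_%:Z - _%:Z); congr nat_of_bool; apply/eqP/eqP; lia.
Qed.

(** With j = [deg1 u + e], the condition that i > j in the same class is [slot (e + 1) e]; the terms
    a_j, a_(j-1) and a_(j+1) correspond to e = 0, 1 and -1. *)
Lemma kformE n m p (deg2 : 'I_m -> int) (deg1 : 'I_p -> int) (b a : dimvec int) :
  (forall i, #|[pred t | deg2 t == i]| = b i) ->
  (forall i, #|[pred t | deg1 t == i]| = a i) ->
  kform n b a = \sum_t \sum_u (2 * (slot n 1 0 (deg1 u) (deg2 t) : nat)%:Z -
     (slot n 2 1 (deg1 u) (deg2 t) : nat)%:Z -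
     (slot n 0 (-1) (deg1 u) (deg2 t) : nat)%:Z).
Proof.
move=> bE aE; rewrite /kform.
(* The three values of o index the terms 2 a_j, a_(j-1) and a_(j+1). *)
pose sh (o : option bool) : int := if o is Some b then if b then 1 else -1 else 0.
pose cf (o : option bool) : int := if o is None then 2 else -1.
have big_opt (f : option bool -> int) :
    \sum_o f o = f None + f (Some true) + f (Some false).
  rewrite (bigD1 None) //= (bigD1 (Some true)) //= (bigD1 (Some false)) //=.
  by rewrite big_pred0 ?addr0 ?addrA //; case=> [[]|].
rewrite (@fsbig_count _ ('I_m * 'I_p * option bool)%type _
   (fun k => (deg2 k.1.1, deg1 k.1.2 + sh k.2)) (fun k => cf k.2)).
  rewrite pair_big /= -(pair_big predT predT (fun tu o =>
    (((deg2 tu.1, deg1 tu.2 + sh o) \in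
     [set p : int * int | p.2 < p.1 /\ cls n p.1 = cls n p.2]%classic) : nat)%:Z *
       cf o)) /=.
  apply: eq_bigr => -[t u] _; rewrite big_opt /= mulrC !mulrN1.
  have slotE e : ((deg2 t, deg1 u + e) \in
     [set p : int * int | p.2 < p.1 /\ cls n p.1 = cls n p.2]%classic) =
     slot n (e + 1) e (deg1 u) (deg2 t).
    apply/idP/andP; rewrite inE /=.
      move=> [lt /eqP]; rewrite cls_eqE opprD addrA => dv; split=> //; lia.
    move=> [lt dv]; split; first lia.
    by apply/eqP; rewrite cls_eqE opprD addrA.
  by rewrite !slotE.
move=> [i j] _ /=; rewrite !(dim_degE _ bE) !(dim_degE _ aE).
rewrite mulr_sumr -!sumrB big_distrlr /= pair_big /=.
rewrite -(pair_big predT predT (fun tu o =>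
    ((i, j) == (deg2 tu.1, deg1 tu.2 + sh o) : nat)%:Z * cf o)) /=.
apply: eq_bigr => -[t u] _; rewrite big_opt /= !xpair_eqE !mulrN1 addr0.
rewrite [deg2 t == i]eq_sym; case: (i == deg2 t); rewrite ?mul0r //= mul1r.
rewrite mulrC; congr (_%:Z * _ - _%:Z - _%:Z);
  by congr nat_of_bool; apply/eqP/eqP; lia.
Qed.

Lemma mformE (I : choiceType) (sh : I -> I) m p (deg2 : 'I_m -> I)
    (deg1 : 'I_p -> I) (b a : dimvec I) :
  (forall i, #|[pred t | deg2 t == i]| = b i) ->
  (forall i, #|[pred t | deg1 t == i]| = a i) ->
  (mform sh b a)%:Z = \sum_t \sum_u ((deg1 u == sh (deg2 t) : nat)%:Z +
     (deg1 u == deg2 t : nat)%:Z).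
Proof.
move=> bE aE; rewrite /mform Posz_sum.
transitivity (\sum_(i <- finsupp b)
  \sum_t (deg2 t == i : nat)%:Z * ((a (sh i))%:Z + (a i)%:Z)).
  apply: eq_bigr => i _.
  by rewrite -mulnDr PoszM PoszD (dim_degE _ bE) mulr_suml.
rewrite exchange_big; apply: eq_bigr => t _ /=.
have tb : deg2 t \in finsupp b.
  by rewrite mem_finsupp -bE -lt0n; apply/card_gt0P; exists t; rewrite inE.
rewrite (bigD1_seq (deg2 t)) ?fset_uniq //= eqxx mul1r big1 ?addr0.
  by rewrite !(dim_degE _ aE) -big_split.
by move=> i /negbTE; rewrite eq_sym => ->; rewrite mul0r.
Qed.

(* Every term is a sum over pairs (t, u) of basis vectors of V/U and U of a
   quantity depending on their degrees, and the identity holds pair by pair. *)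
Lemma exponent_identity n r s (deg' : 'I_(r + s) -> int) (a b d : dimvec int)
    (alpha beta : dimvec 'I_n.+1) :
  (forall i, #|[pred t : 'I_r | deg' (lshift s t) == i]| = a i) ->
  (forall i, #|[pred t : 'I_s | deg' (rshift r t) == i]| = b i) ->
  (forall i, #|[pred t | deg' t == i]| = d i) ->
  (forall c, #|[pred t : 'I_r | cls n (deg' (lshift s t)) == c]| = alpha c) ->
  (forall c, #|[pred t : 'I_s | cls n (deg' (rshift r t)) == c]| = beta c) ->
  kform n b a - (mform succz b a)%:Z - hform n a - hform n b =
  - hform n d - (mform (@ordS n.+1) beta alpha)%:Z +
  2 * (#|[pred tu : 'I_r * 'I_s |
         slot n 1 0 (deg' (lshift s tu.1)) (deg' (rshift r tu.2))]| +
       #|[pred tu : 'I_s * 'I_r |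
         slot n 2 1 (deg' (rshift r tu.1)) (deg' (lshift s tu.2))]|)%N%:Z.
Proof.
move=> aE bE dE alphaE betaE.
rewrite (kformE n bE aE) (mformE succz bE aE) (mformE (@ordS n.+1) betaE alphaE).
rewrite (hformE n aE) (hformE n bE) (hformE n dE) PoszD !card_Posz.
rewrite big_split_ord /=.
rewrite [\sum_(i < r) \sum_(u < r + s) _](eq_bigr (fun t =>
  \sum_(u < r) ((slot n 2 1 (deg' (lshift s t)) (deg' (lshift s u)) : nat)%:Z -
                (slot n 1 0 (deg' (lshift s t)) (deg' (lshift s u)) : nat)%:Z) +
  \sum_(u < s) ((slot n 2 1 (deg' (lshift s t)) (deg' (rshift r u)) : nat)%:Z -
                (slot n 1 0 (deg' (lshift s t)) (deg' (rshift r u)) : nat)%:Z)));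
  last by move=> t _; rewrite big_split_ord.
rewrite [\sum_(i < s) \sum_(u < r + s) _](eq_bigr (fun t =>
  \sum_(u < r) ((slot n 2 1 (deg' (rshift r t)) (deg' (lshift s u)) : nat)%:Z -
                (slot n 1 0 (deg' (rshift r t)) (deg' (lshift s u)) : nat)%:Z) +
  \sum_(u < s) ((slot n 2 1 (deg' (rshift r t)) (deg' (rshift r u)) : nat)%:Z -
                (slot n 1 0 (deg' (rshift r t)) (deg' (rshift r u)) : nat)%:Z)));
  last by move=> t _; rewrite big_split_ord.
rewrite !big_split /=.
set ha := \sum_(t < r) \sum_(u < r) _; set hb := \sum_(t < s) \sum_(u < s) _.
rewrite [\sum_(i < r) \sum_(u < s) _]exchange_big /=.
rewrite -[X in 2 * (X + _)](pair_big predT predT (fun t u =>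
  (slot n 1 0 (deg' (lshift s t)) (deg' (rshift r u)) : nat)%:Z)) /=.
rewrite -[X in 2 * (_ + X)](pair_big predT predT (fun t u =>
  (slot n 2 1 (deg' (rshift r t)) (deg' (lshift s u)) : nat)%:Z)) /=.
rewrite [X in 2 * (X + _)]exchange_big /=.
set K := \sum_(t < s) \sum_(u < r) (2 * _ - _ - _).
set M := \sum_(t < s) \sum_(u < r) ((_ == succz _ : nat)%:Z + _).
set M' := \sum_(t < s) \sum_(u < r) ((_ == ordS _ : nat)%:Z + _).
set H1 := \sum_(t < s) \sum_(u < r) (_%:Z - _%:Z).
set H2 := \sum_(t < s) \sum_(u < r) (_%:Z - _%:Z).
set A := \sum_(t < s) \sum_(u < r) _%:Z; set B := \sum_(t < s) \sum_(u < r) _%:Z.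
(* The pairs inside U and the pairs inside V/U cancel; only mixed pairs remain. *)
have lin (k m p q m' x y z w : int) : k - m + p + q + m' - 2 * (x + y) = 0 ->
    k - m - z - w = - (z + p + (q + w)) - m' + 2 * (x + y) by lia.
apply: lin.
pose S (f : 'I_s -> 'I_r -> int) := \sum_t \sum_u f t u.
have SD f f' : S f + S f' = S (fun t u => f t u + f' t u).
  by rewrite /S -big_split; apply: eq_bigr => t _; rewrite -big_split.
have SB f f' : S f - S f' = S (fun t u => f t u - f' t u).
  by rewrite /S -sumrB; apply: eq_bigr => t _; rewrite -sumrB.
have S2 f : 2 * S f = S (fun t u => 2 * f t u).
  by rewrite /S mulr_sumr; apply: eq_bigr => t _; rewrite mulr_sumr.
rewrite /K /M /H1 /H2 /M' /A /B -!/(S _) SB !SD S2 SB.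
apply: big1 => t _; apply: big1 => u _ /=.
move: (deg' (rshift r t)) (deg' (lshift s u)) => p w.
rewrite /slot /succz ordS_cls !cls_eqE.
have -> : w - (p + 1) = w - p - 1 by lia.
have -> : p - w - -1 = - (w - p - 1) by lia.
have -> : p - w - 0 = - (w - p) by rewrite subr0 opprB.
rewrite !rpredN !subr0; set E0 := (_ %| w - p)%Z; set E1 := (_ %| w - p - 1)%Z.
set E2 := (_ %| p - w - 1)%Z.
have E0P : p = w -> E0 by move=> pw; rewrite /E0 pw subrr dvdz0.
have E1P : w = p + 1 -> E1 by move=> pw; rewrite /E1 pw addrAC addrK subrr dvdz0.
(* The terms with [E2] cancel. Those with [E0] balance because one of w < p, w = p, w > p holds,
   those with [E1] because one of w <= p, w = p + 1, w >= p + 2 holds; the equalities come from the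
   form of the infinite quiver. *)
clearbody E0 E1 E2; case: E0 E0P; case: E1 E1P; case: E2 => E1P E0P;
  rewrite ?andbT ?andbF /=; try (have E0N : p <> w by move/E0P);
  try (have E1N : w <> p + 1 by move/E1P); lia.
Qed.

End Exponents.

(** * Standard representations *)

Section StandardRepresentations.
Variables (F : fieldType) (I : choiceType) (sh : I -> I) (lam : mseg I).

Local Notation B := (mbasis lam).
Local Notation e := (tnth (in_tuple (mbasis lam))).

Lemma mem_mbasis p m k : ((p, m, k) \in B) = (m < lam p)%N && (k <= p.2)%N.
Proof.
apply/allpairsPdep/andP => [[pm [k' [/allpairsPdep[p' [m' [_ + ->]]] + [-> -> ->]]]]|].
  by rewrite !mem_iota.
move=> [mp kp]; exists (p, m), k; split=> //; last by rewrite mem_iota.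
apply/allpairsPdep; exists p, m; split=> //; last by rewrite mem_iota.
by rewrite mem_finsupp -lt0n; apply: leq_ltn_trans mp.
Qed.

Lemma uniq_mbasis : uniq B.
Proof.
apply: allpairs_uniq_dep => [|pm _|[pm k] [pm' k'] _ _ [-> ->] //].
  apply: allpairs_uniq_dep => [|p _|[p m] [p' m'] _ _ [-> ->] //].
    exact: fset_uniq.
  exact: iota_uniq.
exact: iota_uniq.
Qed.

Lemma big_mbasis (f : (I * nat) * nat -> nat) :
  (\sum_(t < size B) f ((e t).1.1, (e t).2) =
   \sum_(p <- finsupp lam) lam p * \sum_(k <- iota 0 p.2.+1) f (p, k))%N.
Proof.
rewrite -(big_tnth _ _ B predT (fun x => f (x.1.1, x.2))) big_allpairs_dep /=.
rewrite big_allpairs_dep /=; apply: eq_bigr => p _.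
by rewrite big_const_seq count_predT size_iota iter_addn_0 mulnC.
Qed.

Lemma mrepE : mrep sh F lam = crep (fun t => Defs.mdeg sh (e t))
  (\matrix_(t, u) (e u == ((e t).1, (e t).2.+1))%:R).
Proof. by []. Qed.

Lemma mrep_dim i :
  #|[pred t | Defs.mdeg sh (e t) == i]| = mdim sh lam i.
Proof.
rewrite -sum1_card big_mkcond /=.
rewrite /mdim.
rewrite (eq_bigr (fun t => (iter (e t).2 sh (e t).1.1.1 == i : nat))); last first.
  by move=> t _; rewrite inE /Defs.mdeg; case: eqP.
rewrite (big_mbasis (fun x => (iter x.2 sh x.1.1 == i : nat))).
by apply: eq_bigr => p _; rewrite -sum1_count [in RHS]big_mkcond; congr (_ * _)%N;
  apply: eq_bigr => k _ /=; case: eqP.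
Qed.

Let M : 'M[F]_(size B) := \matrix_(t, u) (e u == ((e t).1, (e t).2.+1))%:R.

Let e_inj : injective e.
Proof. by apply/tuple_uniqP; apply: uniq_mbasis. Qed.

Let e_mem x : x \in B -> exists t, e t = x.
Proof. by move=> xB; have /tnthP[t ->] : x \in in_tuple B by []; exists t. Qed.

Lemma mrep_act_exp k t u :
  (M ^+ k) t u = (e u == ((e t).1, ((e t).2 + k)%N))%:R.
Proof.
elim: k u => [|k IHk] u.
  rewrite expr0 mxE addn0 -surjective_pairing (inj_eq e_inj) eq_sym.
  by case: eqP.
rewrite exprSr mxE.
have [/existsP[w /eqP ew]|] := boolP [exists w, e w == ((e t).1, ((e t).2 + k)%N)].
  rewrite (bigD1 w) //= IHk ew eqxx mul1r big1 ?addr0 ?mxE ?ew ?addnS //=.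
  by move=> w' ne; rewrite IHk -ew (inj_eq e_inj) (negbTE ne) mul0r.
move/existsPn => ne; rewrite big1; last by move=> w _; rewrite IHk (negbTE (ne w)) mul0r.
case: eqP => // eu; have : (e u) \in B := mem_tnth u (in_tuple B).
have := mem_tnth t (in_tuple B); rewrite eu; move: (ne); move: (e t) => -[[p m] j] {}ne.
rewrite !mem_mbasis /= => /andP[mp _] /andP[_ jp].
have [|w ew] := @e_mem (p, m, (j + k)%N).
  by rewrite mem_mbasis mp; apply: leq_trans jp; rewrite addnS.
by have := ne w; rewrite ew eqxx.
Qed.

(** Under k arrows a basis vector either moves along its segment or dies; the rank counts the
    survivors. *)
Lemma rank_mrep i k :
  \rank (gr (mrep sh F lam) i *m act (mrep sh F lam) ^+ k) =
  (\sum_(p <- finsupp lam) lam p *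
     \sum_(j <- iota 0 p.2.+1) ((iter j sh p.1 == i) && (j + k <= p.2)))%N.
Proof.
rewrite -(big_mbasis (fun x => ((iter x.2 sh x.1.1 == i) && (x.2 + k <= x.1.2)%N : nat))).
rewrite mrepE /= -/M.
set A := _ *m _.
pose Q t := (Defs.mdeg sh (e t) == i) && ((e t).2 + k <= (e t).1.1.2)%N.
have QE t u : A t u = (Q t && (e u == ((e t).1, ((e t).2 + k)%N)))%:R.
  rewrite dmx_mulE mrep_act_exp /Q; case: (_ == i) => //=.
  case: eqP => [eu|]; rewrite ?andbF // andbT.
  have : (e u) \in B := mem_tnth u (in_tuple B); rewrite eu.
  by case: (e t) => -[[? ?] ?] ?; rewrite mem_mbasis /= => /andP[_ ->].
have QP t : Q t -> exists u, e u = ((e t).1, ((e t).2 + k)%N).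
  move=> /andP[_ le]; apply: e_mem; have := mem_tnth t (in_tuple B).
  by move: le; case: (e t) => -[[? ?] ?] ? /= le; rewrite !mem_mbasis le => /andP[-> _].
(* [A] has at most one nonzero entry, equal to 1, in each row and column, so this product is the
   projection to the surviving rows. *)
have AAT : A *m A^T = dmx F Q.
  apply/matrixP => t t'; rewrite mxE [RHS]mxE [X in X *+ _]mxE.
  have [Qt|/negbTE Qt] := boolP (Q t); last first.
    by rewrite mul0rn big1 // => u _; rewrite QE Qt mul0r.
  have [u eu] := QP t Qt.
  rewrite (bigD1 u) //= [A^T _ _]mxE !QE Qt eu eqxx mul1r big1 ?addr0; last first.
    by move=> u' ne; rewrite QE Qt -eu (inj_eq e_inj) (negbTE ne) mul0r.
  have [tt'|ne] := eqVneq t t'; first by rewrite -tt' Qt eqxx.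
  case: eqP; rewrite ?andbF // => -[E1 /eqP]; rewrite eqn_add2r => /eqP E2.
  case/eqP: ne; apply: e_inj.
  by rewrite [e t]surjective_pairing [e t']surjective_pairing E1 E2.
have QA : dmx F Q *m A = A.
  by apply/matrixP => t u; rewrite dmx_mulE !QE; case: (Q t).
have -> : \rank A = \rank (dmx F Q).
  apply/eqP; rewrite eqn_leq -{1}QA mxrankM_maxl -AAT.
  exact: mxrankM_maxl.
rewrite rank_dmx -sum1_card big_mkcond /=; apply: eq_bigr => t _.
by rewrite unfold_in /Q; case: ifP.
Qed.

End StandardRepresentations.

Lemma iso_rank (F : fieldType) (I : choiceType) (V W : grep F I) i k :
  iso V W -> \rank (gr V i *m act V ^+ k) = \rank (gr W i *m act W ^+ k).
Proof.
case=> g [h [gh hg gact ggr]].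
have gfree : row_free g by apply/row_freeP; exists h.
have actE : act V ^+ k *m g = g *m act W ^+ k.
  elim: k => [|k IHk]; first by rewrite !expr0 mul1mx mulmx1.
  have exprSm m (A : 'M[F]_m) : A ^+ k.+1 = A *m A ^+ k by rewrite exprS.
  by rewrite !exprSm -mulmxA IHk !mulmxA gact.
rewrite -(mxrankMfree _ gfree) -mulmxA actE mulmxA.
by apply: eqmx_rank; apply/andP; have /andP[le1 le2] := ggr i; split; apply: submxMr.
Qed.

Section Segments.

Lemma iter_succz j i : iter j succz i = i + j%:Z.
Proof.
elim: j => [|j IHj]; first by rewrite addr0.
by rewrite iterS IHj /succz -addrA -PoszD addn1.
Qed.

(** On the infinite quiver a segment meets each vertex at most once, so only j = i - a can
    contribute. *)
Lemma span_count (a i : int) (l k : nat) :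
  (\sum_(j <- iota 0 l.+1) ((iter j succz a == i) && (j + k <= l)) =
   (a <= i)%R && (i + k%:Z <= a + l%:Z)%R :> nat)%N.
Proof.
have [ai|ai] := boolP (a <= i)%R; last first.
  by rewrite big1 // => j _; rewrite iter_succz; case: eqP => // aj; lia.
have [ik|ik] := boolP (i + k%:Z <= a + l%:Z)%R; last first.
  rewrite big1 // => j _; rewrite iter_succz; case: eqP => //= aj.
  by case: leqP => // le; lia.
rewrite (bigD1_seq `|i - a|%N) ?iota_uniq //; last by rewrite mem_iota; lia.
rewrite iter_succz big1 ?addn0.
  have -> : a + `|i - a|%N%:Z == i by lia.
  by have -> : (`|i - a| + k <= l)%N by lia.
by move=> j ne; rewrite iter_succz; case: eqP => //= aj; case/eqP: ne; lia.
Qed.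

Lemma span_mult (a i : int) (l k : nat) :
  (((a <= i)%R && (i + k%:Z <= a + l%:Z)%R) +
   ((a <= i - 1)%R && (i - 1 + k.+2%:Z <= a + l%:Z)%R) =
   ((a == i) && (l == k)) +
   ((a <= i - 1)%R && (i - 1 + k.+1%:Z <= a + l%:Z)%R) +
   ((a <= i)%R && (i + k.+1%:Z <= a + l%:Z)%R))%N.
Proof. lia. Qed.

Definition nspan (lam : mseg int) (i : int) (k : nat) : nat :=
  (\sum_(p <- finsupp lam) lam p *
     ((p.1 <= i)%R && (i + k%:Z <= p.1 + p.2%:Z)%R))%N.

Lemma rank_mrepZ (F : fieldType) (lam : mseg int) i k :
  \rank (gr (mrep succz F lam) i *m act (mrep succz F lam) ^+ k) = nspan lam i k.
Proof.
by rewrite rank_mrep; apply: eq_bigr => p _; congr (_ * _)%N; apply: span_count.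
Qed.

(* Inclusion-exclusion: the segments starting at i of length k + 1 are those
   containing [i, i + k], minus those extending it to the left or right. *)
Lemma nspan_mult (lam : mseg int) i k :
  (nspan lam i k + nspan lam (i - 1) k.+2 =
   lam (i, k) + nspan lam (i - 1) k.+1 + nspan lam i k.+1)%N.
Proof.
have -> : lam (i, k) = (\sum_(p <- finsupp lam) lam p * (p == (i, k)))%N.
  have [ls|/fsfun_dflt ls] := boolP ((i, k) \in finsupp lam).
    rewrite (bigD1_seq (i, k)) ?fset_uniq //= eqxx muln1 big1 ?addn0 //.
    by move=> p /negbTE ->; rewrite muln0.
  rewrite ls big_seq big1 // => p pl; case: eqP => [E|]; last by rewrite muln0.
  by rewrite -E in ls; rewrite mem_finsupp ls in pl.
rewrite /nspan -!big_split; apply: eq_bigr => -[j l] _ /=.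
rewrite -!mulnDr; congr (_ * _)%N; rewrite xpair_eqE.
exact: span_mult.
Qed.

(** The ranks of iterated arrows are invariants, and [nspan_mult] solves for the multiplicities in
    terms of them. *)
Lemma iso_mrep_inj (F : fieldType) (lam mu : mseg int) :
  iso (mrep succz F lam) (mrep succz F mu) -> lam = mu.
Proof.
move=> lm; have E i k : nspan lam i k = nspan mu i k.
  by rewrite -!(rank_mrepZ F); apply: iso_rank.
apply/fsfunP => -[i k].
by have := nspan_mult lam i k; rewrite !E nspan_mult => /addIn/addIn ->.
Qed.

End Segments.

(** * Specialization *)

Section LaurentEvaluation.
Variables (C : fieldType).
Implicit Types (x y : laurent C) (t : C).

Let tofracX_neq0 k : tofrac ('X : {poly C}) ^+ k != 0.
Proof. by rewrite expf_neq0 // tofrac_eq0 polyX_eq0. Qed.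

Lemma laurent_repr x :
  exists (p : {poly C}) (k : nat), laurent_val x = tofrac p / tofrac 'X ^+ k.
Proof. by have /asboolP[[p k] E] := laurent_valP x; exists p, k. Qed.

Lemma levalD x y t : t != 0 -> leval (x + y) t = leval x t + leval y t.
Proof.
move=> t0; have [p [k xE]] := laurent_repr x; have [r [l yE]] := laurent_repr y.
rewrite (leval_frac t0 xE) (leval_frac t0 yE).
rewrite (@leval_frac _ _ (p * 'X^l + r * 'X^k) (k + l) _ t0).
  by rewrite hornerD !hornerM !hornerXn addf_div ?expf_neq0 // exprD.
rewrite [LHS](_ : _ = laurent_val x + laurent_val y) // xE yE addf_div //.
by rewrite exprD tofracD !tofracM !tofracXn.
Qed.

Lemma levalM x y t : t != 0 -> leval (x * y) t = leval x t * leval y t.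
Proof.
move=> t0; have [p [k xE]] := laurent_repr x; have [r [l yE]] := laurent_repr y.
rewrite (leval_frac t0 xE) (leval_frac t0 yE).
rewrite (@leval_frac _ _ (p * r) (k + l) _ t0).
  by rewrite hornerM mulf_div exprD.
rewrite [LHS](_ : _ = laurent_val x * laurent_val y) // xE yE mulf_div.
by rewrite exprD tofracM.
Qed.

Lemma leval0 t : t != 0 -> leval (0 : laurent C) t = 0.
Proof.
move=> t0; rewrite (@leval_frac _ _ 0 0 _ t0); first by rewrite horner0 mul0r.
by rewrite tofrac0 mul0r.
Qed.

Lemma leval_vpow k t : t != 0 -> leval (vpow C k) t = t ^ k.
Proof.
move=> t0; case: k => k.
  rewrite (@leval_frac _ _ 'X^k 0 _ t0); first by rewrite hornerXn expr0 divr1.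
  by rewrite /= expr0 divr1 tofracXn.
rewrite (@leval_frac _ _ 1 k.+1 _ t0); first by rewrite hornerC mul1r.
by rewrite /= tofrac1 mul1r.
Qed.

(** After clearing denominators the difference is a polynomial. Arbitrarily long lists of points
    stand for infinitely many of them, so one list outnumbers the possible roots. *)
Lemma leval_inj_infinite x y :
  (forall m, exists s : seq C, [/\ uniq s, (m <= size s)%N &
     forall t, t \in s -> t != 0 /\ leval x t = leval y t]) -> x = y.
Proof.
move=> xy; have [p [k xE]] := laurent_repr x; have [r [l yE]] := laurent_repr y.
have D0 : p * 'X^l - r * 'X^k = 0.
  apply/eqP/negPn/negP => D0.
  have [s [us ss sE]] := xy (size (p * 'X^l - r * 'X^k)).
  have : (size s < size (p * 'X^l - r * 'X^k)%R)%N.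
    apply: max_poly_roots => //; apply/allP => t /sE[t0].
    rewrite (leval_frac t0 xE) (leval_frac t0 yE) => /eqP.
    rewrite eqr_div ?expf_neq0 // => /eqP E.
    by rewrite rootE hornerD hornerN !hornerM !hornerXn E subrr.
  by rewrite ltnNge ss.
apply: val_inj => /=; rewrite xE yE; apply/eqP; rewrite eqr_div //.
by rewrite -!tofracXn -!tofracM tofrac_eq -subr_eq0 D0.
Qed.

End LaurentEvaluation.

Section Special.
Variable R : realType.
Notation A := (laurent R[i]).
Variables (I : choiceType) (sh : I -> I) (F : finFieldType) (q : R[i]).
Hypothesis q0 : q != 0.
Implicit Types f g : {malg A[mseg I]}.

Let qV0 : q^-1 != 0. Proof. by rewrite invr_eq0. Qed.

Lemma special_widen f (S : {fset mseg I}) (V : grep F I) :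
  (msupp f `<=` S)%fset ->
  special sh q f V =
  \sum_(lam <- S) leval f@_lam q^-1 * `[< iso V (mrep sh F lam) >]%:R.
Proof.
move=> fS; apply: big_fset_incl => // lam _ /mcoeff_outdom ->.
by rewrite leval0 // mul0r.
Qed.

Lemma specialD f g (V : grep F I) :
  special sh q (f + g) V = special sh q f V + special sh q g V.
Proof.
pose S := (msupp f `|` msupp g)%fset.
rewrite !(@special_widen _ S) ?fsubsetUl ?fsubsetUr ?msuppD_le //.
rewrite -big_split; apply: eq_bigr => lam _ /=.
by rewrite mcoeffD levalD // mulrDl.
Qed.

Lemma special0 (V : grep F I) : special sh q 0 V = 0.
Proof. by rewrite /special msupp0 big_seq_fset0. Qed.

Lemma specialZ c f (V : grep F I) :
  special sh q (c *: f) V = leval c q^-1 * special sh q f V.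
Proof.
rewrite (@special_widen _ (msupp f)) ?msuppZ_le // mulr_sumr.
by apply: eq_bigr => lam _; rewrite mcoeffZ levalM // mulrA.
Qed.

Lemma special_sum (K : Type) (rs : seq K) (f : K -> {malg A[mseg I]})
    (V : grep F I) :
  special sh q (\sum_(k <- rs) f k) V = \sum_(k <- rs) special sh q (f k) V.
Proof.
elim: rs => [|k rs IHrs]; first by rewrite !big_nil special0.
by rewrite !big_cons specialD IHrs.
Qed.

Lemma special_iso f (V W : grep F I) :
  iso V W -> special sh q f V = special sh q f W.
Proof.
move=> VW; apply: eq_bigr => lam _; congr (_ * _%:R); congr nat_of_bool.
by apply/asboolP/asboolP; apply: isoT; first exact: isoS.
Qed.

End Special.

(** Distinct labels give non-isomorphic representations, so only the coefficient of [lam]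
    survives. *)
Lemma special_mrep (R : realType) (F : finFieldType) (q : R[i])
    (f : {malg (laurent R[i])[mseg int]}) lam :
  q != 0 -> special succz q f (mrep succz F lam) = leval f@_lam q^-1.
Proof.
move=> q0; rewrite (@special_widen _ _ _ _ _ q0 _ (lam |` msupp f)%fset) ?fsubsetU1 //.
rewrite (bigD1_seq lam) ?fset_uniq ?fset1U1 //= big1 ?addr0.
  have -> : `[< iso (mrep succz F lam) (mrep succz F lam) >] = true.
    by apply/asboolP/isoR.
  by rewrite mulr1.
move=> mu ne; case: asboolP => [/iso_mrep_inj E|]; last by rewrite mulr0.
by rewrite E eqxx in ne.
Qed.

(* A coefficient is a Laurent polynomial known at the infinitely many points
   p ^ (-1/2), p prime. *)
Lemma malg_special_inj (R : realType) (f g : {malg (laurent R[i])[mseg int]}) :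
  (forall lam (F : finFieldType) (q : R[i]), 0 < q -> q ^+ 2 = #|F|%:R ->
     special succz q f (mrep succz F lam) = special succz q g (mrep succz F lam)) ->
  f = g.
Proof.
move=> fg; apply/malgP => lam; apply: leval_inj_infinite => m.
have [s [us ss sP]] : exists s : seq nat,
    [/\ uniq s, size s = m & forall p, p \in s -> prime p].
  elim: m => [|m [s [us ss sP]]]; first by exists [::].
  have [p pm pp] := prime_above (\max_(x <- s) x).
  exists (p :: s); split=> /=; last first.
  - by move=> x; rewrite inE => /orP[/eqP->|/sP].
  - by rewrite ss.
  rewrite us andbT; apply/negP => ps; move: pm; rewrite ltnNge.
  by rewrite (bigD1_seq p) //= leq_maxl.
pose t p : R[i] := (sqrtC p%:R)^-1.
exists [seq t p | p <- s]; split.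
- rewrite map_inj_uniq // => p p' /invr_inj E; apply/eqP.
  by rewrite -(eqr_nat R[i]) -[p%:R]sqrtCK -[p'%:R]sqrtCK E.
- by rewrite size_map ss.
move=> _ /mapP[p /sP pp ->].
have q0 : 0 < sqrtC p%:R :> R[i] by rewrite sqrtC_gt0 ltr0n prime_gt0.
split; first by rewrite invr_eq0 gt_eqF.
have qF : sqrtC p%:R ^+ 2 = #|{: 'F_p}|%:R :> R[i] by rewrite sqrtCK card_Fp.
have := fg lam 'F_p (sqrtC p%:R) q0 qF.
by rewrite !special_mrep ?gt_eqF.
Qed.

(** * The coordinate form of gamma *)

Lemma daddE (I : choiceType) (a b : dimvec I) i : dadd a b i = (a i + b i)%N.
Proof.
rewrite fsfunE in_fsetU; case: ifPn => //; rewrite negb_or => /andP[ai bi].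
by rewrite !fsfun_dflt.
Qed.

Lemma sum_finsupp_deg (I : choiceType) m (deg : 'I_m -> I) (d : dimvec I)
    (Q : pred I) :
  (forall i, #|[pred t | deg t == i]| = d i) ->
  (\sum_(i <- finsupp d | Q i) d i = #|[pred t | Q (deg t)]|)%N.
Proof.
move=> dE.
transitivity (\sum_(i <- finsupp d | Q i) \sum_t (deg t == i))%N.
  apply: eq_bigr => i _; rewrite -dE -sum1_card big_mkcond /=.
  by apply: eq_bigr => t _; rewrite inE; case: eqP.
rewrite exchange_big -sum1_card [RHS]big_mkcond /=; apply: eq_bigr => t _.
have td : deg t \in finsupp d.
  by rewrite mem_finsupp -dE -lt0n; apply/card_gt0P; exists t; rewrite inE.
rewrite big_mkcond (bigD1_seq (deg t)) ?fset_uniq //= eqxx inE big1 ?addn0 //.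
by move=> i /negbTE; rewrite eq_sym => ->; case: ifP.
Qed.

Lemma dbarE n m (deg : 'I_m -> int) (d : dimvec int) c :
  (forall i, #|[pred t | deg t == i]| = d i) ->
  #|[pred t | cls n (deg t) == c]| = dbar n d c.
Proof.
move=> dE; rewrite -(sum_finsupp_deg (fun i => cls n i == c) dE) fsfunE.
case: ifPn => // cN; rewrite big_seq_cond big1 // => i /andP[id /eqP ic].
by case/negP: cN; apply/imfsetP; exists i.
Qed.

Lemma exists_dimvec (I : choiceType) m (deg : 'I_m -> I) :
  exists d : dimvec I, forall i, #|[pred t | deg t == i]| = d i.
Proof.
exists [fsfun i in [fset deg t | t : 'I_m]%fset => #|[pred t | deg t == i]|].
move=> i; rewrite fsfunE; case: ifPn => // iN; apply: eq_card0 => t.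
by rewrite inE; apply/negP => /eqP ti; case/negP: iN; apply/imfsetP; exists t.
Qed.

Lemma dmx_sums (F : fieldType) (I : choiceType) m (deg : 'I_m -> I)
    (d : dimvec I) (Q : pred I) :
  (forall i, #|[pred t | deg t == i]| = d i) ->
  (\sum_(i <- finsupp d | Q i) dmx F (fun t => (deg t == i)%B) :=:
   dmx F (fun t => Q (deg t)))%MS.
Proof.
move=> dE; apply/eqmxP/andP; split.
  apply: sumsmx_seq_sub => i _ Qi; apply/sub_dmxP => t u; rewrite !mxE.
  case: (t =P u) => [<-|_]; last by rewrite eqxx.
  by case: (deg t =P i) => [->|]; rewrite ?Qi ?eqxx.
apply/row_subP => t; have [Qt|/negbTE Qt] := boolP (Q (deg t)); last first.
  suff -> : row t (dmx F (fun t => Q (deg t))) = 0 by rewrite sub0mx.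
  by apply/rowP => u; rewrite !mxE Qt mul0rn.
have td : deg t \in finsupp d.
  by rewrite mem_finsupp -dE -lt0n; apply/card_gt0P; exists t; rewrite inE.
apply: (sumsmx_seq_sup td Qt).
suff -> : row t (dmx F (fun t => Q (deg t))) =
    row t (dmx F (fun u => deg u == deg t)) by apply: row_sub.
by apply/rowP => u; rewrite !mxE Qt eqxx.
Qed.

Lemma crep_graded (F : fieldType) (I : choiceType) m (deg : 'I_m -> I)
    (x : 'M[F]_m) (d : dimvec I) :
  (forall i, #|[pred t | deg t == i]| = d i) -> graded d (crep deg x).
Proof.
move=> dE; split=> [i||] /=.
- by rewrite rank_dmx -dE; apply: eq_card.
- by rewrite (sum_finsupp_deg predT dE) cardT size_enum_ord.
- rewrite -sub1mx (dmx_sums F predT dE); apply/sub_dmxP => //.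
Qed.

Lemma crep_is_rep (F : fieldType) (I : choiceType) (sh : I -> I) m
    (deg : 'I_m -> I) (x : 'M[F]_m) (d : dimvec I) :
  (forall i, #|[pred t | deg t == i]| = d i) ->
  (forall t u, x t u != 0 -> deg u = sh (deg t)) ->
  (exists k, x ^+ k = 0) -> is_rep sh d (crep deg x).
Proof.
move=> dE xdeg xnil; split=> //; first exact: crep_graded.
move=> i /=; apply/sub_dmxP => t u; rewrite dmx_mulE.
by case: (deg t =P i) => [<- /xdeg->|]; rewrite ?eqxx.
Qed.

Section SameSpaces.
Variables (F : fieldType) (I : choiceType) (m : nat).
Variables (V W : I -> 'M[F]_m) (y : 'M[F]_m).
Hypothesis VW : forall i, (V i :=: W i)%MS.

(** [barrep] sums subspaces where [crep] has a diagonal matrix: the row spaces agree, the matrices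
    need not. *)
Lemma eqmx_iso : iso (GRep V y) (GRep W y).
Proof.
exists 1%:M, 1%:M; split; rewrite /= ?mulmx1 ?mul1mx // => i.
by rewrite mulmx1; apply/eqmxP.
Qed.

Lemma eqmx_is_rep (sh : I -> I) d : is_rep sh d (GRep V y) -> is_rep sh d (GRep W y).
Proof.
case=> -[/= rk dm full] st nil; split=> //=.
  split=> //= [i|]; first by rewrite -VW.
  move: full; rewrite -!sub1mx => full; apply: (submx_trans full).
  by apply: sumsmx_seq_sub => i il _; apply: (sumsmx_seq_sup il); rewrite ?VW.
by move=> i; rewrite -(eqmxMr y (VW i)) -VW; apply: st.
Qed.

End SameSpaces.

Section GammaCoordinates.
Variables (n : nat) (F : fieldType) (m : nat) (deg : 'I_m -> int).
Variables (d : dimvec int) (x : 'M[F]_m).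
Hypothesis dE : forall i, #|[pred t | deg t == i]| = d i.
Hypothesis xdeg : forall t u, x t u != 0 -> deg u = deg t + 1.

Local Notation cdeg := (fun t => cls n (deg t)).

Lemma fge_crep i :
  (fge d (crep deg x) i :=: dmx F (fun u => (i <= deg u)%R))%MS.
Proof. exact: (dmx_sums F (fun j => (i <= j)%R) dE). Qed.

Lemma gr_barrep (y : 'M[F]_m) c :
  (gr (barrep n d (V := crep deg x) y) c :=: gr (crep cdeg y) c)%MS.
Proof. exact: (dmx_sums F (fun j => cls n j == c) dE). Qed.

Lemma barrep_iso (y : 'M[F]_m) :
  iso (barrep n d (V := crep deg x) y) (crep cdeg y).
Proof. exact: (@eqmx_iso _ _ _ _ _ y (gr_barrep y)). Qed.

Lemma pat_step (y : 'M[F]_m) : pat n 2 1 deg deg (y - x) -> pat n 1 1 deg deg y.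
Proof.
move=> yx; rewrite -[y](subrK x); apply: patD; first exact: patW yx.
apply/patP => t u /xdeg ->; rewrite /slot lexx /=.
have -> : deg t + 1 - deg t - 1 = 0 by lia.
exact: dvdz0.
Qed.

Lemma crep_cls_is_rep (y : 'M[F]_m) :
  pat n 1 1 deg deg y -> is_rep (@ordS n.+1) (dbar n d) (crep cdeg y).
Proof.
move=> yP; apply: crep_is_rep.
- by move=> c; apply: dbarE.
- move=> t u; move/patP: yP => yP /yP/andP[_ dv].
  by apply/eqP; rewrite ordS_cls cls_eqE opprD addrA.
- exact: pat_nilpotent yP.
Qed.

(** The bound 2 comes from [assoc_gr] and the residue 1 from the cyclic grading of y. Conversely the
    pattern makes y raise degrees by at least 1, so y is filtered and nilpotent. *)
Lemma filtered_assoc_gr (y : 'M[F]_m) :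
  (filtered n d (V := crep deg x) y /\ assoc_gr d (V := crep deg x) y x) <->
  pat n 2 1 deg deg (y - x).
Proof.
split=> [[[[_ ystep _] _] yx]|yx].
  apply/patP => t u yxtu; apply/andP; split.
    have := yx (deg t); rewrite fge_crep => /sub_dmxP/(_ t u).
    by rewrite dmx_mulE eqxx; apply.
  suff /eqP : cls n (deg u) = cls n (deg t + 1) by rewrite cls_eqE opprD addrA.
  have [x0|/xdeg -> //] := eqVneq (x t u) 0.
  have ytu : y t u != 0 by rewrite !mxE x0 subr0 in yxtu.
  have := ystep (cls n (deg t)); rewrite (eqmxMr _ (gr_barrep y _)) gr_barrep.
  rewrite -ordS_cls => /sub_dmxP/(_ t u); rewrite dmx_mulE eqxx => /(_ ytu).
  by move/eqP.
have yP := pat_step yx; split; first split.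
- have E c : (gr (crep cdeg y) c :=: gr (barrep n d (V := crep deg x) y) c)%MS.
    exact/eqmx_sym/gr_barrep.
  exact: (eqmx_is_rep E (crep_cls_is_rep yP)).
- move=> i; rewrite (eqmxMr _ (fge_crep i)) fge_crep; apply/sub_dmxP => t u.
  rewrite dmx_mulE; case: ifP => [it|]; last by rewrite eqxx.
  move/(elimT (patP _ _ _ _ _ _) yP)/andP => [le _].
  by apply: le_trans le; rewrite lerD2r.
- move=> i; rewrite fge_crep; apply/sub_dmxP => t u.
  rewrite dmx_mulE; case: (deg t =P i) => [<-|]; last by rewrite eqxx.
  by move/(elimT (patP _ _ _ _ _ _) yx)/andP => [].
Qed.

End GammaCoordinates.

Lemma gammaF_crep (R : realType) n (F : finFieldType) (q : R[i]) m
    (deg : 'I_m -> int) (d : dimvec int) (x : 'M[F]_m)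
    (f : grep F 'I_n.+1 -> R[i]) :
  (forall i, #|[pred t | deg t == i]| = d i) ->
  (forall t u, x t u != 0 -> deg u = deg t + 1) ->
  (forall V W, iso V W -> f V = f W) ->
  gammaF q d f (crep deg x) =
  q ^ (- hform n d) *
  \sum_(y : 'M[F]_m | pat n 2 1 deg deg (y - x)) f (crep (fun t => cls n (deg t)) y).
Proof.
move=> dE xdeg fiso; congr (_ * _); apply: eq_big => [y|y _].
  apply/asboolP/idP => [H|H]; first exact/(filtered_assoc_gr n dE xdeg).
  exact/(filtered_assoc_gr n dE xdeg).
exact/fiso/barrep_iso.
Qed.

Section AdaptedRepresentations.
Variables (F : fieldType) (N r s : nat).
Variables (deg : 'I_N -> int) (deg' : 'I_(r + s) -> int) (x : 'M[F]_N).
Variables (h : 'M[F]_(r + s, N)) (g : 'M[F]_(N, r + s)).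
Hypothesis hgP : adapted deg deg' h g.
Hypothesis xdeg : forall t u, x t u != 0 -> deg u = deg t + 1.
Hypothesis xnil : exists k, x ^+ k = 0.
Hypothesis Ux : ursubmx (h *m x *m g) = 0.

(** Conjugation by [h] exchanges the degree projections of the two bases, and their ranks are the
    two counts. *)
Lemma adapted_card i :
  #|[pred t | deg' t == i]| = #|[pred t | deg t == i]|.
Proof.
have [hg gh hdeg] := hgP.
have hfree : row_free h by apply/row_freeP; exists g.
have hfull : row_full h by apply/row_fullP; exists g.
have := congr1 mxrank (preserves_comm i hdeg).
by rewrite (mxrankMfree _ hfree) (eqmxMfull _ hfull) !rank_dmx => /esym.
Qed.

Lemma adapted_step t u : (h *m x *m g) t u != 0 -> deg' u = deg' t + 1.
Proof.
have [hg gh hdeg] := hgP; have gdeg := adapted_inv hgP.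
rewrite mxE => hxg; apply/eqP.
have [/existsP[w /andP[hx /gdeg E]]|/existsPn ne] :=
    boolP [exists w, ((h *m x) t w != 0) && (g w u != 0)]; last first.
  case/eqP: hxg; apply: big1 => w _; have := ne w.
  by rewrite negb_and !negbK => /orP[]/eqP->; rewrite ?mul0r ?mulr0.
rewrite mxE in hx.
have [/existsP[v /andP[/hdeg E1 /xdeg E2]]|/existsPn ne] :=
    boolP [exists v, (h t v != 0) && (x v w != 0)]; last first.
  case/eqP: hx; apply: big1 => v _; have := ne v.
  by rewrite negb_and !negbK => /orP[]/eqP->; rewrite ?mul0r ?mulr0.
by rewrite E1 -E2 E.
Qed.

Lemma adapted_sub_step t u :
  ulsubmx (h *m x *m g) t u != 0 -> deg' (lshift s u) = deg' (lshift s t) + 1.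
Proof. by rewrite mxE mxE; apply: adapted_step. Qed.

Lemma adapted_quo_step t u :
  drsubmx (h *m x *m g) t u != 0 -> deg' (rshift r u) = deg' (rshift r t) + 1.
Proof. by rewrite mxE mxE; apply: adapted_step. Qed.

End AdaptedRepresentations.

(** * Decomposition of the Hall product *)

Lemma card_split_ord r s (P : pred 'I_(r + s)) :
  #|P| = (#|[pred t | P (lshift s t)]| + #|[pred t | P (rshift r t)]|)%N.
Proof. by rewrite -!sum1_card ![\sum_(t in _) _]big_mkcond big_split_ord. Qed.

Lemma card_rshift r s (deg' : 'I_(r + s) -> int) (a b d : dimvec int) :
  dadd a b = d ->
  (forall i, #|[pred t | deg' t == i]| = d i) ->
  (forall i, #|[pred t | deg' (lshift s t) == i]| = a i) ->
  forall i, #|[pred t | deg' (rshift r t) == i]| = b i.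
Proof.
move=> <- dE aE i; have := dE i; rewrite daddE -aE card_split_ord.
by move/addnI.
Qed.

Lemma succ_nilpotent (F : fieldType) m (deg1 : 'I_m -> int) (y : 'M[F]_m) :
  (forall t u, y t u != 0 -> deg1 u = deg1 t + 1) -> exists k, y ^+ k = 0.
Proof.
move=> ydeg; apply: (@pat_nilpotent 0 _ _ deg1 1); apply/patP => t u /ydeg ->.
rewrite /slot lexx /=; have -> : deg1 t + 1 - deg1 t - 1 = 0 by lia.
exact: dvdz0.
Qed.

Section Decomposition.
Variables (R : realType) (n : nat) (F : finFieldType) (q : R[i]).
Hypothesis q0 : q != 0.
Hypothesis qF : q ^+ 2 = #|F|%:R.
Variables (N : nat) (deg : 'I_N -> int) (x : 'M[F]_N) (d : dimvec int).
Hypothesis dE : forall i, #|[pred t | deg t == i]| = d i.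
Hypothesis xdeg : forall t u, x t u != 0 -> deg u = deg t + 1.
Variables (alpha beta : dimvec 'I_n.+1).
Hypothesis d_bar : dbar n d = dadd alpha beta.

Local Notation cdeg := (fun t => cls n (deg t)).

Section Term.
Variables phi psi : grep F 'I_n.+1 -> R[i].
Hypothesis phi_iso : forall V W, iso V W -> phi V = phi W.
Hypothesis psi_iso : forall V W, iso V W -> psi V = psi W.
Variables (a b : dimvec int) (Phi Psi : grep F int -> R[i]).
Hypothesis Phi_iso : forall V W, iso V W -> Phi V = Phi W.
Hypothesis Psi_iso : forall V W, iso V W -> Psi V = Psi W.
Hypothesis PhiE : forall V, is_rep succz a V -> Phi V = gammaF q a phi V.
Hypothesis PsiE : forall V, is_rep succz b V -> Psi V = gammaF q b psi V.
Hypothesis abd : dadd a b = d.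
Hypothesis a_bar : dbar n a = alpha.
Hypothesis b_bar : dbar n b = beta.

(** [Phi] and [Psi] stand for the values of gamma_a(f) and gamma_b(g), [phi] and [psi] for those of
    f and g. *)
Lemma hall_term (U : 'M[F]_N) :
  subrep a (V := crep deg x) U ->
  q ^ kform n b a * (q ^- mform succz b a *
    (Phi (restr (V := crep deg x) U) * Psi (quo (V := crep deg x) U))) =
  q ^ (- hform n d) * (q ^- mform (@ordS n.+1) beta alpha *
    \sum_(y : 'M[F]_N | pat n 2 1 deg deg (y - x))
      \sum_(W : 'M[F]_N |
          `[< subrep alpha (V := crep cdeg y) W >] && (grW deg W == U))
        phi (restr (V := crep cdeg y) W) * psi (quo (V := crep cdeg y) W)).
Proof.
move=> sU; have UU : <<U>>%MS = U by case: sU.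
have [r [s [deg' [h [g [hgP Uh]]]]]] :=
  graded_adapted (fun i => subrep_proj i sU).
have [Ux aE] := (subrep_adapted hgP Uh x a UU).1 sU.
have d'E i : #|[pred t | deg' t == i]| = d i by rewrite (adapted_card hgP) dE.
have bE := card_rshift abd d'E aE.
have alphaE c : #|[pred t | cls n (deg' (lshift s t)) == c]| = alpha c.
  by rewrite -a_bar; exact: (@dbarE n _ (fun t => deg' (lshift s t)) a c aE).
have betaE c : #|[pred t | cls n (deg' (rshift r t)) == c]| = beta c.
  by rewrite -b_bar; exact: (@dbarE n _ (fun t => deg' (rshift r t)) b c bE).
rewrite (fiber_sum xdeg phi_iso psi_iso hgP Uh UU Ux alphaE).
have x1deg := adapted_sub_step hgP xdeg; have x2deg := adapted_quo_step hgP xdeg.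
rewrite (Phi_iso (iso_restr_adapted hgP Uh Ux)) (Psi_iso (iso_quo_adapted hgP Uh Ux)).
rewrite PhiE; last exact: crep_is_rep aE x1deg (succ_nilpotent x1deg).
rewrite PsiE; last exact: crep_is_rep bE x2deg (succ_nilpotent x2deg).
rewrite (gammaF_crep _ aE x1deg phi_iso) (gammaF_crep _ bE x2deg psi_iso).
set A := \sum_(y | _) _; set B := \sum_(y | _) _.
(* The field has q^2 elements, whence the factor 2 in [exponent_identity]. *)
rewrite !card_mx_support -expnD natrX -qF -exprM.
have := exponent_identity aE bE d'E alphaE betaE.
set c := (_ + _)%N => expE.
transitivity (q ^ (kform n b a - (mform succz b a)%:Z - hform n a - hform n b) * (A * B)).
  by rewrite !expfzDr // !exprnN [LHS](AC (1*(1*((1*1)*(1*1)))) (1*2*3*5*(4*6))).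
by rewrite expE !expfzDr // exprnN -PoszM !mulrA.
Qed.

End Term.

Lemma grW_decomposition (y W : 'M[F]_N) :
  pat n 2 1 deg deg (y - x) -> subrep alpha (V := crep cdeg y) W ->
  exists a b : dimvec int, [/\ dadd a b = d, dbar n a = alpha, dbar n b = beta &
    subrep a (V := crep deg x) (grW deg W)].
Proof.
move=> yx sW; have [WW /= Wy _ _] := sW.
have UU : <<grW deg W>>%MS = grW deg W by rewrite genmx_id.
have [r [s [deg' [h [g [hgP Uh]]]]]] := graded_adapted (grW_proj deg W).
have Ux : ursubmx (h *m x *m g) = 0.
  by apply/eqP; rewrite -(stable_adapted hgP Uh); apply: grW_stable xdeg yx Wy.
have alphaE := subrep_cls_dim hgP Uh sW erefl.
have [a aE] := exists_dimvec (fun t => deg' (lshift s t)).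
have [b bE] := exists_dimvec (fun t => deg' (rshift r t)).
have d'E i : #|[pred t | deg' t == i]| = d i by rewrite (adapted_card hgP) dE.
have abd : dadd a b = d.
  by apply/fsfunP => i; rewrite daddE -aE -bE -d'E [RHS]card_split_ord.
have a_bar : dbar n a = alpha.
  by apply/fsfunP => c; rewrite -(dbarE c aE) alphaE.
exists a, b; split=> //; last exact/(subrep_adapted hgP Uh).
(* The class of [b] follows by cancelling [alpha] in the class of [d]. *)
apply/fsfunP => c; apply: (@addnI (alpha c)); rewrite -[RHS]daddE -d_bar.
by rewrite -(dbarE c d'E) -alphaE -(dbarE c bE) [RHS]card_split_ord.
Qed.

Lemma dim_unique (a a' b b' : dimvec int) :
  dadd a b = d -> dadd a' b' = d -> a =1 a' -> (a, b) = (a', b').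
Proof.
move=> ab ab' aa; have E : a = a' by apply/fsfunP.
rewrite E; congr pair; apply/fsfunP => i; apply: (@addnI (a' i)).
by rewrite -[RHS]daddE ab' -ab daddE E.
Qed.

End Decomposition.

(** * Finiteness, regrouping and conclusion *)

(** Since a is bounded by d, the pair (a, b) is coded by a function from the support of d to a
    finite interval. *)
Lemma finite_decompositions (d : dimvec int) (P : set (dimvec int * dimvec int)) :
  (forall ab, P ab -> dadd ab.1 ab.2 = d) -> cardinality.finite_set P.
Proof.
move=> Pd; pose s : seq int := finsupp d; pose m := \max_(i <- s) d i.
pose K := {ffun 'I_(size s) -> 'I_m.+1}.
pose fk (k : K) i := if insub (index i s) is Some t then k t : nat else 0%N.
pose fa k : dimvec int := [fsfun i in finsupp d => fk k i].
pose fb k : dimvec int := [fsfun i in finsupp d => (d i - fk k i)%N].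
apply: (@cardinality.sub_finite_set _ _ [set (fa k, fb k) | k in [set: K]]%classic);
  last by apply: cardinality.finite_image; apply: cardinality.finite_finset.
move=> [a b] /Pd /= abd.
have adE i : (a i + b i)%N = d i by rewrite -abd daddE.
pose k : K := [ffun t => inord (a (nth 0 s (val t)))].
have kE i : i \in finsupp d -> fk k i = a i.
  move=> id; rewrite /fk; case: insubP => [t _ ti|]; last by rewrite index_mem id.
  rewrite ffunE ti nth_index // inordK // ltnS.
  apply: leq_trans (leq_bigmax_seq _ id erefl).
  by rewrite -adE leq_addr.
exists k => //; congr pair; apply/fsfunP => i; rewrite fsfunE;
  case: ifPn => [/kE -> //|/fsfun_dflt di].
- by have := adE i; rewrite di; lia.
- by rewrite -adE addKn.
- by have := adE i; rewrite di; lia.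
Qed.

(** Pairs (y, W) are sorted by U = [gr W]; the hypothesis says that each U reached in this way
    belongs to exactly one index k. *)
Lemma sum_fibers (V : nmodType) (K : eqType) (rs : seq K) (T Y : finType)
    (S : K -> pred T) (Q : pred Y) (P : Y -> pred T) (gr : T -> T)
    (G : Y -> T -> V) :
  uniq rs ->
  (forall y W, Q y -> P y W -> exists2 k, k \in rs & S k (gr W) /\
     forall k', k' \in rs -> S k' (gr W) -> k' = k) ->
  \sum_(k <- rs) \sum_(U | S k U) \sum_(y | Q y) \sum_(W | P y W && (gr W == U)) G y W =
  \sum_(y | Q y) \sum_(W | P y W) G y W.
Proof.
move=> urs SP.
have E k : \sum_(U | S k U) \sum_(y | Q y) \sum_(W | P y W && (gr W == U)) G y W =
    \sum_(y | Q y) \sum_(W | P y W) if S k (gr W) then G y W else 0.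
  rewrite exchange_big; apply: eq_bigr => y _ /=.
  rewrite (exchange_big_dep (P y)) /=; last by move=> U W _ /andP[].
  apply: eq_bigr => W PW; rewrite PW /=; case: ifPn => SW.
    by rewrite (big_pred1 (gr W)) // => U /=; case: (gr W =P U) => [<-|ne];
      rewrite ?andbT ?SW ?andbF ?eqxx // eq_sym; apply/esym/eqP.
  by rewrite big_pred0 // => U; case: eqP => [<-|]; rewrite ?andbF // (negbTE SW).
rewrite (eq_bigr _ (fun k _ => E k)) exchange_big; apply: eq_bigr => y Qy /=.
rewrite exchange_big; apply: eq_bigr => W PW /=.
have [k krs [Sk ku]] := SP y W Qy PW.
rewrite (bigD1_seq k) //= Sk big_seq_cond big1 ?addr0 // => k' /andP[k'rs ne].
by case: ifP => // Sk'; rewrite (ku k' k'rs Sk') eqxx in ne.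
Qed.

Lemma homog_mcoeff0 (R : realType) (I : choiceType) (sh : I -> I) (d : dimvec I)
    (f : {malg (laurent R[i])[mseg I]}) lam :
  homog sh d f -> ~ (forall i, mdim sh lam i = d i) -> f@_lam = 0.
Proof.
move=> fd lamd; apply: mcoeff_outdom; apply/negP => lamf; apply: lamd.
exact: fd lam lamf.
Qed.

Lemma mrep_step (F : fieldType) (lam : mseg int) t u :
  act (mrep succz F lam) t u != 0 ->
  Defs.mdeg succz (tnth (in_tuple (mbasis lam)) u) =
  Defs.mdeg succz (tnth (in_tuple (mbasis lam)) t) + 1.
Proof.
by rewrite mxE; case: (tnth _ u =P _) => [-> _|]; rewrite ?eqxx // /Defs.mdeg iterS.
Qed.

Theorem proposition6p1 (R : realType) (n : nat)
    (Un : hall_algebra R (@ordS n.+1)) (Uoo : hall_algebra R succz)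
    (gamma : gamma_maps R n)
    (alpha beta : dimvec 'I_n.+1) (d : dimvec int)
    (d_bar : dbar n d = dadd alpha beta)
    (f g : {malg (laurent R[i])[mseg 'I_n.+1]})
    (f_alpha : homog (@ordS n.+1) alpha f)
    (g_beta : homog (@ordS n.+1) beta g) :
  \sum_(ab \in [set ab : dimvec int * dimvec int |
                 [/\ dadd ab.1 ab.2 = d, dbar n ab.1 = alpha
                   & dbar n ab.2 = beta]]%classic)
    vpow R[i] (- kform n ab.2 ab.1) *:
      hmul Uoo (gam gamma ab.1 f) (gam gamma ab.2 g)
  = gam gamma d (hmul Un f g).
Proof.
set S := [set ab | _]%classic.
have Sfin : cardinality.finite_set S by apply: (finite_decompositions (d := d)) => ab [].
rewrite fsbig_finite //=; set rs := cardinality.fset_set S.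
have rsP ab : ab \in rs ->
    [/\ dadd ab.1 ab.2 = d, dbar n ab.1 = alpha & dbar n ab.2 = beta].
  by rewrite cardinality.in_fset_set // inE.
have rsI ab : S ab -> ab \in rs by move=> Sab; rewrite cardinality.in_fset_set // inE.
have fg_d : homog (@ordS n.+1) (dbar n d) (hmul Un f g).
  by rewrite d_bar; apply: hmul_homog.
apply: malg_special_inj => lam F q q_gt0 qF; have q0 : q != 0 by rewrite gt_eqF.
rewrite special_sum //.
have f_a ab : ab \in rs -> homog succz ab.1 (gam gamma ab.1 f).
  by move=> /rsP[_ aE _]; apply: gam_homog; rewrite aE.
have g_b ab : ab \in rs -> homog succz ab.2 (gam gamma ab.2 g).
  by move=> /rsP[_ _ bE]; apply: gam_homog; rewrite bE.
(* If [lam] has another dimension than d, both coefficients vanish by homogeneity; the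
   specialization formulas speak only of dimension d. *)
have [lam_d|lam_d] := pselect (forall i, mdim succz lam i = d i); last first.
  rewrite special_mrep // (homog_mcoeff0 (gam_homog fg_d) lam_d).
  rewrite leval0 ?invr_eq0 // big_seq big1 // => ab ab_rs.
  rewrite special_mrep // mcoeffZ.
  rewrite (@homog_mcoeff0 _ _ succz d) ?mulr0 ?leval0 ?invr_eq0 //.
  by have [<- _ _] := rsP ab ab_rs; apply: hmul_homog; [apply: f_a|apply: g_b].
pose phi : grep F 'I_n.+1 -> R[i] := special (@ordS n.+1) q f.
pose psi : grep F 'I_n.+1 -> R[i] := special (@ordS n.+1) q g.
rewrite mrepE; set deg := fun t => Defs.mdeg _ _; set x := \matrix_(t, u) _.
have dE i : #|[pred t | deg t == i]| = d i by rewrite mrep_dim.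
have xdeg t u : x t u != 0 -> deg u = deg t + 1 by apply: mrep_step.
have Vrep : is_rep succz d (crep deg x).
  by apply: crep_is_rep; [exact: dE|exact: xdeg|exact: (succ_nilpotent xdeg)].
have iso_fn u (V W : grep F 'I_n.+1) : iso V W ->
  special (@ordS n.+1) q u V = special (@ordS n.+1) q u W by apply: special_iso.
have iso_foo u (V W : grep F int) : iso V W ->
  special succz q u V = special succz q u W by apply: special_iso.
rewrite (gam_special gamma q_gt0 qF fg_d Vrep) (gammaF_crep _ dE xdeg (iso_fn _)).
pose G (y W : 'M[F]_(size (mbasis lam))) :=
  phi (restr (V := crep (fun t => cls n (deg t)) y) W) *
  psi (quo (V := crep (fun t => cls n (deg t)) y) W).
(* Both sides meet in the sum over pairs (y, W): the left one after regrouping by [grW], the right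
   one by expanding the product under the sum over y. *)
transitivity (q ^ (- hform n d) * (q ^- mform (@ordS n.+1) beta alpha *
  \sum_(y | pat n 2 1 deg deg (y - x))
    \sum_(W | `[< subrep alpha (V := crep (fun t => cls n (deg t)) y) W >]) G y W)).
  rewrite -(@sum_fibers _ _ rs _ _
    (fun ab U => `[< subrep ab.1 (V := crep deg x) U >]) _ _ (grW deg)) ?fset_uniq //.
    rewrite !mulr_sumr big_seq [RHS]big_seq; apply: eq_bigr => ab ab_rs.
    have [abd aE bE] := rsP ab ab_rs.
    rewrite specialZ // leval_vpow ?invr_eq0 // exprz_inv opprK.
    rewrite (hmul_special Uoo q_gt0 qF (f_a ab ab_rs) (g_b ab ab_rs)) ?abd //.
    rewrite /hallprod !mulr_sumr; apply: eq_bigr => U /asboolP sU.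
    have f_dbar : homog (@ordS n.+1) (dbar n ab.1) f by rewrite aE.
    have g_dbar : homog (@ordS n.+1) (dbar n ab.2) g by rewrite bE.
    exact: (hall_term q0 qF dE xdeg (iso_fn f) (iso_fn g)
      (iso_foo (gam gamma ab.1 f)) (iso_foo (gam gamma ab.2 g))
      (fun V => gam_special gamma q_gt0 qF f_dbar (V := V))
      (fun V => gam_special gamma q_gt0 qF g_dbar (V := V)) abd aE bE sU).
  move=> y W yx /asboolP sW.
  have [a [b [abd aE bE sU]]] := grW_decomposition dE xdeg d_bar yx sW.
  exists (a, b); first exact: rsI.
  (* The ranks of [grW deg W] determine a, and then b is d - a. *)
  split=> [|[a' b'] /rsP[abd' _ _] /asboolP sU']; first exact/asboolP.
  apply: dim_unique abd' abd _ => i.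
  by have [_ _ _ <-] := sU; have [_ _ _ <-] := sU'.
congr (_ * _); rewrite mulr_sumr; apply: eq_bigr => y yx.
rewrite (hmul_special Un q_gt0 qF f_alpha g_beta) //.
rewrite -d_bar; apply: crep_cls_is_rep => //; exact: (pat_step xdeg yx).
Qed.
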